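(* Let $0<\alpha<1$ and suppose that $u,v\in L^1(\mathbb{R})$. For each choice of sign $\pm$: if $$u={}^{\pm}I^{\alpha}v\quad\text{a.e. in }\mathbb{R},$$ then ${}^{\pm}\mathcal{D}^{\alpha}u=v$ almost everywhere. The converse (that ${}^{\pm}\mathcal{D}^{\alpha}u=v$ a.e. implies $u={}^{\pm}I^{\alpha}v$ a.e. in $\mathbb{R}$) is true under the additional assumption that $u(x)\to0$ almost everywhere as $|x|\to\infty$.
   Context: Fractional integrals on $\mathbb{R}$, for $\sigma>0$: ${}^{-}I^{\sigma}f(x)=\frac{1}{\Gamma(\sigma)}\int_{-\infty}^x\frac{f(y)}{(x-y)^{1-\sigma}}\,dy$ and ${}^{+}I^{\sigma}f(x)=\frac{1}{\Gamma(\sigma)}\int_x^\infty\frac{f(y)}{(y-x)^{1-\sigma}}\,dy$. For $0<\alpha<1$: ${}^{-}D^{\alpha}\varphi=\frac{d}{dx}\,{}^{-}I^{1-\alpha}\varphi$ and ${}^{+}D^{\alpha}\varphi=-\frac{d}{dx}\,{}^{+}I^{1-\alpha}\varphi$. Weak fractional derivatives ($0<\alpha<1$): for $u\in L^1(\mathbb{R})$, a function $v\in L^1_{loc}(\mathbb{R})$ is the left (resp. right) weak fractional derivative of $u$, written $v={}^{-}\mathcal{D}^{\alpha}u$ (resp. $v={}^{+}\mathcal{D}^{\alpha}u$), if $\int_{\mathbb{R}} v\varphi\,dx=\int_{\mathbb{R}} u\,{}^{+}D^{\alpha}\varphi\,dx$ (resp. $\int_{\mathbb{R}} v\varphi\,dx=\int_{\mathbb{R}}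 u\,{}^{-}D^{\alpha}\varphi\,dx$) for all $\varphi\in C_0^\infty(\mathbb{R})$. ''$u(x)\to0$ almost everywhere as $|x|\to\infty$'' means: there is a null set $N$ such that $u(x)\to0$ as $|x|\to\infty$ with $x\notin N$. *)

(* Defs.v *)
From mathcomp Require Import all_boot all_order all_algebra.
From mathcomp Require Import all_classical all_reals all_analysis.
Set Implicit Arguments.
Unset Strict Implicit.
Unset Printing Implicit Defensive.
Import Order.TTheory GRing.Theory Num.Theory.
Import numFieldNormedType.Exports.
Local Open Scope classical_set_scope.
Local Open Scope ring_scope.

Definition Gamma (R : realType) (a : R) : R :=
  \int[@lebesgue_measure R]_(t in `]0, +oo[) (t `^ (a - 1) * expR (- t)).

(* The sign of a fractional operator: Minus integrates over ]-oo, x[,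
   Plus over ]x, +oo[. *)
Variant direction := Minus | Plus.

Definition opposite (s : direction) : direction :=
  match s with Minus => Plus | Plus => Minus end.

(* Wherever the integral does not converge this takes the junk value of the
   real-valued integral; for f in L^1 and 0 < sigma <= 1 that
   happens only on a null set. *)
Definition fracI (R : realType) (s : direction) (sigma : R) (f : R -> R)
    (x : R) : R :=
  match s with
  | Minus => (Gamma sigma)^-1 *
      \int[@lebesgue_measure R]_(y in `]-oo, x[) (f y / (x - y) `^ (1 - sigma))
  | Plus => (Gamma sigma)^-1 *
      \int[@lebesgue_measure R]_(y in `]x, +oo[) (f y / (y - x) `^ (1 - sigma))
  end.

Definition fracD (R : realType) (s : direction) (alpha : R) (phi : R -> R)
    (x : R) : R :=
  match s with
  | Minus => derive1 (fracI Minus (1 - alpha) phi) x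
  | Plus => - derive1 (fracI Plus (1 - alpha) phi) x
  end.

Definition smooth (R : realType) (f : R -> R) : Prop :=
  forall (n : nat) (x : R), derivable (derive1n n f) x 1.

Definition test_function (R : realType) (f : R -> R) : Prop :=
  smooth f /\ compact (closure [set x | f x != 0]).

Definition L1 (R : realType) (f : R -> R) : Prop :=
  (@lebesgue_measure R).-integrable setT (EFin \o f).

(* A relation, because weak derivatives need not exist and are determined only
   up to null sets. *)
Definition is_weak_fracD (R : realType) (s : direction) (alpha : R)
    (u v : R -> R) : Prop :=
  locally_integrable setT v /\
  forall phi : R -> R, test_function phi ->
    \int[@lebesgue_measure R]_x (v x * phi x) =
    \int[@lebesgue_measure R]_x (u x * fracD (opposite s) alpha phi x).

(* The weak derivative of u exists and equals v almost everywhere. *)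
Definition weak_fracD_ae_eq (R : realType) (s : direction) (alpha : R)
    (u v : R -> R) : Prop :=
  exists2 w : R -> R, is_weak_fracD s alpha u w &
    w = v %[ae @lebesgue_measure R].

Definition vanishes_ae_at_infinity (R : realType) (u : R -> R) : Prop :=
  exists2 N : set R, (@lebesgue_measure R).-negligible N &
    forall e : R, 0 < e ->
      exists M : R, forall x : R, ~ N x -> M < `|x| -> `|u x| < e.

(* Main.v *)
(* With [e = 1] for Minus and [e = -1] for Plus, write the fractional integral as
   [J_e^s f x = \int_t f (x - e t) k_s(t)] with [k_s(t) = t^(s-1) / Gamma s] on
   [t > 0].  Fubini makes [J_{-e}^s] the adjoint of [J_e^s], the Beta integral gives
   [J_e^s J_e^(1-s) f x = \int_(q > 0) f (x - e q)], and differentiation under the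
   integral gives [(J_e^s f)' = J_e^s f'].  Hence the fractional derivative of a test
   function [phi] adjoint to [J_e^a] is [- e J_{-e}^(1-a) phi'], and [J_{-e}^a] maps it
   back to [phi]; pairing with [v] is the direct implication.
   Conversely, for a test function [psi] the function [J_{-e}^a psi] has fractional
   derivative [psi].  It is a limit of test functions whose fractional derivatives
   converge boundedly to [psi], so the weak equation passes to the limit and reads
   [\int (J_e^a v) psi = \int u psi]; thus [u = J_e^a v] almost everywhere. *)
Require Import Defs.
From mathcomp Require Import all_boot all_order all_algebra.
From mathcomp Require Import all_classical all_reals all_analysis.
From mathcomp Require Import ring lra measurable_realfun.
Set Implicit Arguments.
Unset Strict Implicit.
Unset Printing Implicit Defensive.
Import Order.TTheory GRing.Theory Num.Theory.
Import numFieldNormedType.Exports.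
Local Open Scope classical_set_scope.
Local Open Scope ring_scope.

(** * Affine changes of variables *)

Section affine_change_of_variables.
Context {R : realType}.
Local Notation mu := (@lebesgue_measure R).

(** [u] and [v] are only in L1, so whatever is paired with them must be bounded uniformly; a
    one-sided kernel spreads the support of its argument to infinity, so compact support alone does
    not help. Two estimates do. For bounded integrable f, splitting the kernel at T gives |J^s f| <=
    c T^s sup|f| + k_s(T) ||f||_1. For a composition, the Beta integral applied to absolute values
    gives J^s |J^(1-s) f| <= ||f||_1, although J^(1-s) f need not be integrable. The converse uses
    both: with Psi = J_{-e}^a psi and a cutoff chi_n falling from 1 to 0 over a layer of length
    about n, (Psi chi_n)' = Psi' chi_n + Psi chi_n'. The second estimate controls the first term;
    the other term has sup norm O(1/n) and L1 norm O(1), so T = n makes its integral of order 1 - a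
    an O(n^-a). Real-valued integrals are total, with value 0 on divergence. Exchanges of integrals
    are therefore first made for nonnegative functions in the extended reals, and the finiteness
    found there feeds Fubini. *)

Lemma measurable_affine (a b : R) :
  measurable_fun setT ((fun x => a * x + b) : measurableTypeR R -> measurableTypeR R).
Proof. by apply: measurable_funD => //; exact: measurable_funM. Qed.

(** Both sides are measures in [A] that agree on the half-open intervals []x, y]], which determine
    Lebesgue measure. For negative [a] the preimage is closed on the other side, hence the two
    cases. *)
Lemma lebesgue_measure_affine (a b : R) (A : set R) : a != 0 -> measurable A ->
  mu A = (`|a|%:E * mu ((fun x => (a * x + b)%R) @^-1` A))%E.
Proof.
move=> a0 mA.
have na0 : 0 < `|a| by rewrite normr_gt0.
pose phi : measurableTypeR R -> measurableTypeR R := fun x => a * x + b.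
have mphi : measurable_fun setT phi by exact: measurable_affine.
pose nu0 : {measure set (measurableTypeR R) -> \bar R} :=
  mscale (NngNum (ltW na0)) (pushforward mu phi : {measure set _ -> \bar R}).
pose nu := nu0 mphi.
rewrite (lebesgue_measure_unique (mu := nu))// => _ [[x y] _ <-].
rewrite /= /nu /mscale/= /pushforward/=.
have [xy|xy] := leP y x.
  by rewrite set_itv_ge ?bnd_simp -?leNgt// preimage_set0 !measure0 mule0.
rewrite lebesgue_measure_itv/= lte_fin xy.
have [a_gt0|a_lt0|/eqP] := ltgtP 0 a; last by rewrite eq_sym (negbTE a0).
  rewrite (_ : _ @^-1` _ = `](x - b) / a, (y - b) / a]%classic); last first.
    apply/seteqP; split=> z /=; rewrite !in_itv/= ltr_pdivrMr// ler_pdivlMr//;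
    by rewrite ltrBlDr lerBrDr mulrC.
  rewrite lebesgue_measure_itv/= lte_fin ltr_pM2r ?invr_gt0// ltrD2r xy.
  by rewrite gtr0_norm// -EFinB -EFinM; congr (_%:E); field.
rewrite (_ : _ @^-1` _ = `[(y - b) / a, (x - b) / a[%classic); last first.
  apply/seteqP; split=> z /=; rewrite !in_itv/= ltr_ndivlMr// ler_ndivrMr//;
  by rewrite ltrBlDr lerBrDr mulrC andbC.
rewrite lebesgue_measure_itv/= lte_fin ltr_nM2r ?invr_lt0// ltrD2r xy.
by rewrite ltr0_norm// -EFinB -EFinM; congr (_%:E); field.
Qed.

Lemma ge0_integral_affine (a b : R) (f : R -> \bar R) : a != 0 ->
  measurable_fun setT f -> (forall x, 0 <= f x)%E ->
  (\int[mu]_x f x = `|a|%:E * \int[mu]_x f (a * x + b)%R)%E.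
Proof.
move=> a0 mf f0.
have na0 : 0 < `|a| by rewrite normr_gt0.
pose phi : measurableTypeR R -> measurableTypeR R := fun x => a * x + b.
have mphi : measurable_fun setT phi by exact: measurable_affine.
pose nu0 : {measure set (measurableTypeR R) -> \bar R} :=
  mscale (NngNum (ltW na0)) (pushforward mu phi : {measure set _ -> \bar R}).
pose nu := nu0 mphi.
transitivity (\int[nu]_x f x)%E.
  apply: eq_measure_integral => A mA _; exact: lebesgue_measure_affine.
by rewrite ge0_integral_mscale// ge0_integral_pushforward.
Qed.

(** With [|a| = 1] no factor has to be distributed over a difference of possibly infinite integrals,
    so integrability is not assumed. Signed integrands are only ever translated or reflected. *)
Lemma integral_affine (a b : R) (f : R -> \bar R) : `|a| = 1 ->
  measurable_fun setT f ->
  (\int[mu]_x f (a * x + b)%R = \int[mu]_x f x)%E.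
Proof.
move=> a1 mf.
have a0 : a != 0 by rewrite -normr_gt0 a1.
rewrite integralE [RHS]integralE; congr (_ - _)%E; apply/esym.
  rewrite (ge0_integral_affine b a0)//; last exact: measurable_funepos.
  by rewrite a1 mul1e; apply: eq_integral => x _; rewrite !funeposE.
rewrite (ge0_integral_affine b a0)//; last exact: measurable_funeneg.
by rewrite a1 mul1e; apply: eq_integral => x _; rewrite !funenegE.
Qed.

End affine_change_of_variables.

(** * The Gamma function *)

Section Gamma_function.
Context {R : realType}.
Local Notation mu := (@lebesgue_measure R).

Lemma integral_powR_lty (s : R) : 0 < s ->
  (\int[mu]_(t in `]0%R, 1%R]) (t `^ (s - 1))%:E < +oo)%E.
Proof.
(* The index [i.+2] keeps the left endpoint strictly below 1, as the fundamental theorem of calculus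
   on [F i] requires. *)
move=> s0; pose F (i : nat) := `[i.+2%:R^-1 : R, 1]%classic.
have bigF : `]0%R, 1%R]%classic = \bigcup_i F i.
  apply/seteqP; split=> [x|x [i _]] /=; rewrite /F/= !in_itv/=.
    move=> /andP[x0 x1]; exists (Num.truncn x^-1) => //=.
    rewrite in_itv/= x1 andbT invf_ple ?posrE//.
    by rewrite ltW// (lt_le_trans (truncnS_gt _))// ler_nat.
  by move=> /andP[ix ->]; rewrite (lt_le_trans _ ix)// invr_gt0.
have mF i : measurable_fun (F i) (fun t : R => (t `^ (s - 1))%:E).
  by apply/measurable_EFinP; apply: measurable_funTS; exact: measurable_powR.
have ndF : nondecreasing_seq F.
  move=> i j ij; apply/subsetPset => x; rewrite /F/= !in_itv/= => /andP[ix ->].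
  by rewrite (le_trans _ ix)// lef_pV2 ?posrE ?ltr0n// ler_nat.
have F0 i x : F i x -> (0 <= (x `^ (s - 1))%:E)%E by rewrite lee_fin powR_ge0.
have FE i : (\int[mu]_(t in F i) (t `^ (s - 1))%:E <= (s^-1)%:E)%E.
  have i0 : 0 < i.+2%:R^-1 :> R by rewrite invr_gt0.
  have dp (y p : R) : 0 < y -> derivable (fun t : R => t `^ p) y 1.
    by move=> y0; apply: derivable_powR; rewrite in_itv/= y0.
  have cp (y p : R) : 0 < y -> {for y, continuous (fun t : R => t `^ p)}.
    by move=> y0; apply/differentiable_continuous/derivable1_diffP/dp.
  rewrite (@continuous_FTC2 _ _ (fun t => s^-1 * t `^ s)); last 4 first.
  - by rewrite invf_lt1// ltr1n.
  - apply: continuous_in_subspaceT => y; rewrite inE/= in_itv/= => /andP[iy _].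
    by apply: cp; exact: lt_le_trans iy.
  - split.
    + move=> y; rewrite in_itv/= => /andP[iy _].
      by apply: derivableM => //; apply: dp; exact: lt_trans iy.
    + apply: cvg_at_right_filter; apply: cvgM; first exact: cvg_cst.
      exact: cp.
    + apply: cvg_at_left_filter; apply: cvgM; first exact: cvg_cst.
      exact: cp.
  - move=> y; rewrite in_itv/= => /andP[iy _].
    have y0 : 0 < y by exact: lt_trans iy.
    rewrite derive1Ml; last exact: dp.
    by rewrite powR_derive1 ?in_itv/= ?y0// mulrA mulVf ?mul1r// gt_eqF.
  by rewrite -EFinB lee_fin powR1 mulr1 gerBl mulr_ge0 ?powR_ge0// invr_ge0 ltW.
have cF : (\int[mu]_(t in F i) (t `^ (s - 1))%:E @[i --> \oo] -->
    \int[mu]_(t in \bigcup_i F i) (t `^ (s - 1))%:E)%E.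
  by apply: ge0_nondecreasing_set_cvg_integral => // i; exact: measurable_itv.
rewrite bigF -(cvg_lim _ cF)//.
apply: (@le_lt_trans _ _ (s^-1)%:E); last by rewrite ltry.
apply: lime_le; first by apply/cvg_ex; eexists; exact: cF.
by near=> n.
Unshelve. all: by end_near. Qed.

Lemma measurable_Gamma_integrand (s : R) :
  measurable_fun setT (fun t : R => t `^ (s - 1) * expR (- t)).
Proof.
apply: measurable_funM; first exact: measurable_powR.
by apply: measurableT_comp => //; exact: measurable_expR.
Qed.

(** Since [s <= 1], the integrand is at most [t ^ (s - 1)] on []0, 1]] and at most [expR (- t)]
    beyond; the exponential density of rate 1 thus controls the tail. *)
Lemma Gamma_integral_lty (s : R) : 0 < s <= 1 ->
  (\int[mu]_(t in `]0%R, +oo[) (t `^ (s - 1) * expR (- t))%:E < +oo)%E.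
Proof.
move=> /andP[s0 s1].
pose g (t : R) : \bar R := (((fun t : R => (t `^ (s - 1))%R%:E) \_ `]0%R, 1%R]%classic) t
   + (exponential_pdf 1 t)%:E)%E.
have mp : measurable_fun setT (fun t : R => (t `^ (s - 1))%:E).
  by apply/measurable_EFinP; exact: measurable_powR.
have p0 t : (0 <= ((fun t : R => (t `^ (s - 1))%R%:E) \_ `]0%R, 1%R]%classic) t)%E.
  by rewrite patchE; case: ifPn; rewrite ?lee_fin ?powR_ge0.
have mpp : measurable_fun setT ((fun t : R => (t `^ (s - 1))%:E) \_ `]0, 1]%classic).
  by apply/(measurable_restrictT _ _).1 => //; exact: measurable_funTS.
have me : measurable_fun setT (fun t : R => (exponential_pdf 1 t)%:E).
  by apply/measurable_EFinP; exact: measurable_exponential_pdf.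
have e0 t : (0 <= (exponential_pdf 1 t)%:E :> \bar R)%E.
  by rewrite lee_fin exponential_pdf_ge0.
apply: (@le_lt_trans _ _ (\int[mu]_t g t)%E).
  rewrite integral_mkcond; apply: ge0_le_integral => //.
  - move=> t _; rewrite patchE; case: ifPn => // _.
    by rewrite lee_fin mulr_ge0 ?powR_ge0 ?expR_ge0.
  - apply/(measurable_restrictT _ _).1 => //; apply: measurable_funTS.
    apply/measurable_EFinP; exact: measurable_Gamma_integrand.
  - exact: emeasurable_funD.
  - move=> t _; rewrite patchE; case: ifPn => [|_]; last by rewrite adde_ge0.
    rewrite inE/= in_itv/= andbT => t0.
    rewrite /g patchE exponential_pdfE; last exact: ltW.
    rewrite mul1r mulN1r.
    case: ifPn => [|/negP]; rewrite inE/= in_itv/= t0/=.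
      move=> t1; rewrite -EFinD lee_fin (@le_trans _ _ (t `^ (s - 1) * 1))//.
        by rewrite ler_wpM2l ?powR_ge0// -expR0 ler_expR oppr_le0 ltW.
      by rewrite mulr1 lerDl expR_ge0.
    move=> /negP; rewrite -ltNge => t1.
    rewrite (_ : point = 0%E :> \bar R)// add0e lee_fin.
    rewrite ler_piMl ?expR_ge0// -[leRHS](powRr0 t).
    by apply: ler_powR; [exact: ltW|rewrite subr_le0].
rewrite ge0_integralD// integral_exponential_pdf//.
by rewrite -integral_mkcond lte_add_pinfty ?ltry// integral_powR_lty.
Qed.

Lemma Gamma_integral_gt0 (s : R) : 0 < s <= 1 ->
  (0 < \int[mu]_(t in `]0%R, +oo[) (t `^ (s - 1) * expR (- t))%:E)%E.
Proof.
move=> /andP[s0 s1].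
have m D : measurable_fun D (fun t : R => (t `^ (s - 1) * expR (- t))%:E).
  apply/measurable_EFinP; apply: measurable_funTS.
  exact: measurable_Gamma_integrand.
have p t : (0 <= (t `^ (s - 1) * expR (- t))%:E)%E.
  by rewrite lee_fin mulr_ge0 ?powR_ge0 ?expR_ge0.
apply: (@lt_le_trans _ _ (\int[mu]_(t in `]0%R, 1%R]) (expR (-1))%:E)%E).
  rewrite integral_cst//= lebesgue_measure_itv/= lte_fin ltr01 oppr0 adde0.
  by rewrite mule1 lte_fin expR_gt0.
apply: (@le_trans _ _ (\int[mu]_(t in `]0%R, 1%R]) (t `^ (s - 1) * expR (- t))%:E)%E).
  apply: ge0_le_integral => //.
    exact: m.
  move=> t; rewrite /= in_itv/= => /andP[t0 t1].
  rewrite lee_fin -[leLHS]mul1r ler_pM ?expR_ge0//; last by rewrite ler_expR lerN2.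
  rewrite -[leLHS](powRr0 t); apply: ger_powR; first by rewrite t0.
  by rewrite subr_le0.
apply: ge0_subset_integral => //; first exact: m.
by move=> t; rewrite /= !in_itv/= => /andP[->].
Qed.

Lemma EFin_Gamma (s : R) : 0 < s <= 1 ->
  ((Gamma s)%:E =
   \int[mu]_(t in `]0%R, +oo[) (t `^ (s - 1) * expR (- t))%:E)%E.
Proof.
move=> s01; rewrite fineK// ge0_fin_numE ?Gamma_integral_lty//.
by rewrite ltW// Gamma_integral_gt0.
Qed.

Lemma Gamma_gt0 (s : R) : 0 < s <= 1 -> 0 < Gamma s.
Proof. by move=> s01; rewrite -lte_fin EFin_Gamma// Gamma_integral_gt0. Qed.

End Gamma_function.

(** * Fractional kernels and the Beta integral *)

(** The extension by zero turns integrals over half-lines into integrals over the whole line, so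
    that substitutions and exchanges of integrals never have to track domains. *)
Definition fkernel {R : realType} (s t : R) : R :=
  if 0 < t then t `^ (s - 1) / Gamma s else 0.

Section fractional_kernel.
Context {R : realType}.
Local Notation mu := (@lebesgue_measure R).
Local Notation TR := (measurableTypeR R).
Implicit Types s t q : R.

Lemma measurable_linear2 (h : R -> R) (a b : R) : measurable_fun setT h ->
  measurable_fun setT (fun z : TR * TR => h (a * z.1 + b * z.2)).
Proof.
move=> mh; apply: measurableT_comp => //.
by apply: measurable_funD; apply: measurable_funM.
Qed.

Lemma fkernel_le0 s t : t <= 0 -> fkernel s t = 0.
Proof. by rewrite /fkernel leNgt => /negbTE ->. Qed.

Lemma fkernel_ge0 s t : 0 < s <= 1 -> 0 <= fkernel s t.
Proof.
move=> s01; rewrite /fkernel; case: ifP => // _.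
by rewrite divr_ge0 ?powR_ge0// ltW// Gamma_gt0.
Qed.

Lemma measurable_fkernel s : measurable_fun setT (fkernel s).
Proof.
apply: measurable_fun_ifT => //; first exact: measurable_fun_ltr.
by apply: measurable_funM => //; exact: measurable_powR.
Qed.

Lemma fkernelM s q t : 0 < q -> fkernel s (q * t) = q `^ (s - 1) * fkernel s t.
Proof.
move=> q0; rewrite /fkernel pmulr_rgt0//; case: ifPn => [t0|]; last by rewrite mulr0.
by rewrite powRM ?mulrA// ltW.
Qed.

Lemma integral_fkernel_expR s : 0 < s <= 1 ->
  (\int[mu]_t (fkernel s t * expR (- t))%:E = 1)%E.
Proof.
move=> s01; have G0 := Gamma_gt0 s01.
transitivity (\int[mu]_(t in `]0%R, +oo[)
    (((Gamma s)^-1)%:E * (t `^ (s - 1) * expR (- t))%:E))%E.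
  rewrite [RHS]integral_mkcond; apply: eq_integral => t _.
  rewrite patchE /fkernel; case: ifPn => [t0|t0]; case: ifPn => //.
  - by rewrite -EFinM => _; congr (_%:E); ring.
  - by rewrite notin_setE/= in_itv/= t0.
  - by rewrite inE/= in_itv/= (negbTE t0).
  - by rewrite mul0r.
rewrite ge0_integralZl//.
- by rewrite -EFin_Gamma// -EFinM mulVf// gt_eqF.
- by apply/measurable_EFinP; apply: measurable_funTS; exact: measurable_Gamma_integrand.
- by move=> t _; rewrite lee_fin mulr_ge0 ?powR_ge0 ?expR_ge0.
- by rewrite lee_fin invr_ge0 ltW.
Qed.

(** For [s2 = 1 - s1] and [q = 1] this is the Beta integral B(s1, 1 - s1) divided by the two Gamma
    values. It is kept in the extended reals because its finiteness is known only after its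
    value. *)
Definition fkernel_conv s1 s2 q : \bar R :=
  (\int[mu]_t (fkernel s1 t * fkernel s2 (q - t))%:E)%E.

Lemma fkernel_conv_le0 s1 s2 q : q <= 0 -> fkernel_conv s1 s2 q = 0%E.
Proof.
move=> q0; rewrite /fkernel_conv; apply: integral0_eq => t _.
have [t0|t0] := leP t 0; first by rewrite fkernel_le0// mul0r.
by rewrite (fkernel_le0 s2) ?mulr0// subr_le0 (le_trans q0)// ltW.
Qed.

Lemma measurable_fkernel_conv s1 s2 : 0 < s1 <= 1 -> 0 < s2 <= 1 ->
  measurable_fun setT (fun z : TR * TR => fkernel s1 z.1 * fkernel s2 (z.2 - z.1)).
Proof.
move=> s10 s20; apply: measurable_funM.
  by apply: measurableT_comp; [exact: measurable_fkernel|exact: measurable_fst].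
have := @measurable_linear2 _ (-1) 1 (measurable_fkernel s2).
by apply: eq_measurable_fun => z _; rewrite mulN1r mul1r addrC.
Qed.

(** The substitution t -> q t produces the factor q q^(s-1) q^(-s) = 1. *)
Lemma fkernel_conv_scale s q : 0 < s < 1 -> 0 < q ->
  fkernel_conv s (1 - s) q = fkernel_conv s (1 - s) 1.
Proof.
move=> /andP[s0 s1] q0.
have s01 : 0 < s <= 1 by rewrite s0 ltW.
have r01 : 0 < 1 - s <= 1 by rewrite subr_gt0 s1 gerBl ltW.
have mk (p : R) : measurable_fun setT
    (fun t : R => (fkernel s t * fkernel (1 - s) (p - t))%:E).
  apply/measurable_EFinP; apply: measurable_funM; first exact: measurable_fkernel.
  apply: measurableT_comp; first exact: measurable_fkernel.
  exact: measurable_funB.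
have k0 (p t : R) : (0 <= (fkernel s t * fkernel (1 - s) (p - t))%:E)%E.
  by rewrite lee_fin mulr_ge0// fkernel_ge0.
rewrite /fkernel_conv (ge0_integral_affine 0 (lt0r_neq0 q0))//.
rewrite -ge0_integralZl//; last first.
  exact: (measurableT_comp (mk q) (measurable_affine q 0)).
apply: eq_integral => t _; rewrite addr0 gtr0_norm// -EFinM; congr (_%:E).
rewrite -[X in fkernel _ (X - _)]mulr1 -mulrBr !fkernelM//.
have : q * (q `^ (s - 1) * q `^ (1 - s - 1)) = 1.
  rewrite -powRD ?(gt_eqF q0) ?implybT//.
  rewrite (_ : s - 1 + (1 - s - 1) = -1); last by ring.
  by rewrite powR_inv1 ?ltW// mulfV// gt_eqF.
move=> E; have {}E z : q * (q `^ (s - 1) * q `^ (1 - s - 1)) * z = z.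
  by rewrite E mul1r.
by rewrite -[RHS]E mulrACA; exact: mulrA.
Qed.

(** Substitute r = q - t and exchange the integrals. This serves twice: with the exponential for [g]
    it determines the Beta constant, and with general [g] it gives the semigroup identity. *)
Lemma ge0_integral_fkernel2 s1 s2 (g : R -> R) : 0 < s1 <= 1 -> 0 < s2 <= 1 ->
  measurable_fun setT g -> (forall t, 0 <= g t) ->
  (\int[mu]_t \int[mu]_r (fkernel s1 t * fkernel s2 r * g (t + r))%:E =
   \int[mu]_q ((g q)%:E * fkernel_conv s1 s2 q))%E.
Proof.
move=> s10 s20 mg g0.
transitivity (\int[mu]_t \int[mu]_q (fkernel s1 t * fkernel s2 (q - t) * g q)%:E)%E.
  apply: eq_integral => t _.
  rewrite -[RHS](@integral_affine _ 1 t) ?normr1//; last first.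
    apply/measurable_EFinP/measurable_funM => //; apply: measurable_funM => //.
    apply: measurableT_comp; first exact: measurable_fkernel.
    exact: measurable_funB.
  by apply: eq_integral => r _; rewrite mul1r addrK (addrC r).
rewrite (fubini_tonelli (fun z : TR * TR =>
  (fkernel s1 z.1 * fkernel s2 (z.2 - z.1) * g z.2)%:E)).
- apply: eq_integral => q _; rewrite /fkernel_conv -ge0_integralZl//.
  + by apply: eq_integral => t _; rewrite -EFinM mulrC.
  + apply/measurable_EFinP; apply: measurable_funM; first exact: measurable_fkernel.
    apply: measurableT_comp; first exact: measurable_fkernel.
    exact: measurable_funB.
  + by move=> t _; rewrite lee_fin mulr_ge0// fkernel_ge0.
  + by rewrite lee_fin.
- apply/measurable_EFinP/measurable_funM; first exact: measurable_fkernel_conv.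
  by apply: measurableT_comp => //; exact: measurable_snd.
- by move=> z; rewrite lee_fin !mulr_ge0// fkernel_ge0.
Qed.

Lemma integral_itv0y_conv s (h : R -> \bar R) : 0 < s < 1 ->
  (\int[mu]_q (h q * fkernel_conv s (1 - s) q) =
   \int[mu]_(q in `]0%R, +oo[) (h q * fkernel_conv s (1 - s) 1%R))%E.
Proof.
move=> s01; rewrite [RHS]integral_mkcond; apply: eq_integral => q _.
rewrite patchE; case: ifPn; rewrite ?inE ?notin_setE/= in_itv/= andbT.
  by move=> q0; rewrite fkernel_conv_scale.
by move=> /negP; rewrite -leNgt => q0; rewrite fkernel_conv_le0 ?mule0.
Qed.

(* Integrating the Beta integral [fkernel_conv s (1 - s)], which is constant on
   positive reals by scaling, against [expR (- q)] identifies the constant. *)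
Lemma fkernel_conv1 s : 0 < s < 1 -> fkernel_conv s (1 - s) 1 = 1%E.
Proof.
move=> s01; have /andP[s0 s1] := s01.
have sp : 0 < s <= 1 by rewrite s0 ltW.
have rp : 0 < 1 - s <= 1 by rewrite subr_gt0 s1 gerBl ltW.
have me : measurable_fun setT (fun q : R => expR (- q)).
  by apply: measurableT_comp => //; exact: measurable_expR.
have := ge0_integral_fkernel2 sp rp me (fun q => expR_ge0 _).
have c0 : (0 <= fkernel_conv s (1 - s) 1)%E.
  by apply: integral_ge0 => t _; rewrite lee_fin mulr_ge0// fkernel_ge0.
rewrite integral_itv0y_conv// ge0_integralZr//; last first.
  by apply/measurable_EFinP; apply: measurable_funTS.
have -> : (\int[mu]_(q in `]0%R, +oo[) (expR (- q))%:E = 1)%E.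
  rewrite integral_itv_obnd_cbnd; last first.
    by apply/measurable_EFinP; apply: measurable_funTS.
  rewrite integral_mkcond -(integral_exponential_pdf (@ltr01 R)).
  apply: eq_integral => q _; rewrite patchE /exponential_pdf patchE.
  by case: ifPn => // _; rewrite mul1r mulN1r.
(* The exponential of a sum factors, so the double integral is a product of two normalised Gamma
   integrals, each equal to 1. *)
rewrite mul1e => <-; rewrite -(integral_fkernel_expR sp).
apply: eq_integral => t _; transitivity (\int[mu]_r
  ((fkernel s t * expR (- t))%:E * (fkernel (1 - s) r * expR (- r))%:E))%E.
  by apply: eq_integral => r _; rewrite -EFinM opprD expRD mulrACA.
rewrite ge0_integralZl//; last 3 first.
- by apply/measurable_EFinP/measurable_funM => //; exact: measurable_fkernel.
- by move=> r _; rewrite lee_fin mulr_ge0 ?expR_ge0// fkernel_ge0.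
- by rewrite lee_fin mulr_ge0 ?expR_ge0// fkernel_ge0.
by rewrite integral_fkernel_expR// mule1.
Qed.

Lemma ge0_integral_fkernel_semigroup s (g : R -> R) : 0 < s < 1 ->
  measurable_fun setT g -> (forall t, 0 <= g t) ->
  (\int[mu]_t \int[mu]_r (fkernel s t * fkernel (1 - s) r * g (t + r))%:E =
   \int[mu]_(q in `]0%R, +oo[) (g q)%:E)%E.
Proof.
move=> s01 mg g0; have /andP[s0 s1] := s01.
rewrite ge0_integral_fkernel2 ?subr_gt0 ?gerBl ?s0 ?s1 ?ltW//.
rewrite integral_itv0y_conv//; apply: eq_integral => q _.
by rewrite fkernel_conv1// mule1.
Qed.

(** The nonnegative case for [|g|] supplies the absolute convergence that Fubini needs.
    Integrability on the positive half-line is enough, because the convolution of the kernels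
    vanishes elsewhere. *)
Lemma integral_fkernel_semigroup s (g : R -> R) : 0 < s < 1 ->
  measurable_fun setT g -> mu.-integrable `]0, +oo[ (EFin \o g) ->
  (\int[mu]_t \int[mu]_r (fkernel s t * fkernel (1 - s) r * g (t + r))%:E =
   \int[mu]_(q in `]0%R, +oo[) (g q)%:E)%E.
Proof.
move=> s01 mg /integrableP[_ ig]; have /andP[s0 s1] := s01.
have sp : 0 < s <= 1 by rewrite s0 ltW.
have rp : 0 < 1 - s <= 1 by rewrite subr_gt0 s1 gerBl ltW.
have mk t : measurable_fun setT (fun q => fkernel (1 - s) (q - t)).
  apply: measurableT_comp; first exact: measurable_fkernel.
  exact: measurable_funB.
have cov (h : R -> R) : measurable_fun setT h ->
    (\int[mu]_t \int[mu]_r (fkernel s t * fkernel (1 - s) r * h (t + r))%:E =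
    \int[mu]_t \int[mu]_q (fkernel s t * fkernel (1 - s) (q - t) * h q)%:E)%E.
  move=> mh; apply: eq_integral => t _.
  rewrite -[RHS](@integral_affine _ 1 t) ?normr1//; last first.
    by apply/measurable_EFinP/measurable_funM => //; exact: measurable_funM.
  by apply: eq_integral => r _; rewrite mul1r addrK (addrC r).
rewrite cov//.
pose F (z : TR * TR) := ((fkernel s z.1 * fkernel (1 - s) (z.2 - z.1) * g z.2)%:E)%E.
have iF : (mu \x mu)%E.-integrable setT F.
  apply/integrable12ltyP.
    apply/measurable_EFinP/measurable_funM; first exact: measurable_fkernel_conv.
    by apply: measurableT_comp => //; exact: measurable_snd.
  rewrite (le_lt_trans _ ig)//= -(ge0_integral_fkernel_semigroup s01)//; last first.
    exact: measurableT_comp.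
  rewrite (cov (fun q => `|g q|)); last exact: measurableT_comp.
  rewrite le_eqVlt; apply/orP; left; apply/eqP.
  apply: eq_integral => t _; apply: eq_integral => q _.
  by rewrite !normrM !(ger0_norm (fkernel_ge0 _ _)).
rewrite (Fubini iF) /F/=.
transitivity (\int[mu]_q ((g q)%:E * fkernel_conv s (1 - s) q))%E.
  apply: eq_integral => q _; rewrite /fkernel_conv.
  have mkk : measurable_fun setT
      (fun t => (fkernel s t * fkernel (1 - s) (q - t))%:E).
    apply/measurable_EFinP/measurable_funM; first exact: measurable_fkernel.
    apply: measurableT_comp; first exact: measurable_fkernel.
    exact: measurable_funB.
  have kk0 t : (0 <= (fkernel s t * fkernel (1 - s) (q - t))%:E)%E.
    by rewrite lee_fin mulr_ge0// fkernel_ge0.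
  rewrite -integralZl//; first by apply: eq_integral => t _; rewrite -EFinM mulrC.
  apply/integrableP; split => //.
  under eq_integral do rewrite gee0_abs//.
  have [q0|q0] := leP q 0; first by rewrite -/(fkernel_conv _ _ _) fkernel_conv_le0.
  by rewrite -/(fkernel_conv _ _ _) fkernel_conv_scale// fkernel_conv1// ltry.
rewrite integral_itv0y_conv//; apply: eq_integral => q _.
by rewrite fkernel_conv1// mule1.
Qed.

End fractional_kernel.

(** * Smooth functions *)

Section smooth_functions.
Context {R : realType}.
Implicit Types (f g : R -> R) (x : R) (n : nat).

Lemma derive1_is_derive f (df : R -> R) :
  (forall x, is_derive x 1 f (df x)) ->
  (forall x, derivable f x 1) /\ derive1 f = df.
Proof.
move=> fdf; split=> [x|]; first by have [] := fdf x.
by apply/funext => x; rewrite derive1E; have [] := fdf x.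
Qed.

Lemma derivable_continuous f : (forall x, derivable f x 1) -> continuous f.
Proof. by move=> df x; apply/differentiable_continuous/derivable1_diffP. Qed.

Lemma derivable_is_derive1 f x : derivable f x 1 -> is_derive x 1 f (derive1 f x).
Proof. by move=> df; rewrite derive1E; exact: derivableP. Qed.

(** The recursion peels off the first derivative instead of the last one, so closure under sums,
    products and inverses follows by induction on [n] with the functions generalised. *)
Fixpoint nderivable n f : Prop :=
  if n is n'.+1 then (forall x, derivable f x 1) /\ nderivable n' (derive1 f) else True.

Lemma nderivableS n f : nderivable n.+1 f -> nderivable n f.
Proof. by elim: n f => // n IH f [df /IH]; split. Qed.

Lemma smoothP f : smooth f <-> forall n, nderivable n f.
Proof.
split=> [sf n|nf n].
  elim: n f sf => // n IH f sf; split.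
    by move=> x; have := sf 0%N x; rewrite derive1n0.
  by apply: IH => k x; rewrite -derive1Sn; exact: sf.
elim: n f nf => [|n IH] f nf x; first by rewrite derive1n0; exact: (nf 1%N).1.
by rewrite derive1Sn; apply: IH => k; exact: (nf k.+1).2.
Qed.

Lemma smooth_derivable f : smooth f -> forall x, derivable f x 1.
Proof. by move=> /smoothP/(_ 1%N)[]. Qed.

Lemma smooth_continuous f : smooth f -> continuous f.
Proof. by move=> /smooth_derivable/derivable_continuous. Qed.

Lemma smooth_derive1 f : smooth f -> smooth (derive1 f).
Proof. by move=> /smoothP sf; apply/smoothP => n; have [] := sf n.+1. Qed.

(** Meant for families closed under differentiation: the flat exponentials, and the fractional
    integrals of smooth functions supported in a fixed interval. *)
Lemma smooth_coind (P : (R -> R) -> Prop) :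
  (forall f, P f -> (forall x, derivable f x 1) /\ P (derive1 f)) ->
  forall f, P f -> smooth f.
Proof.
move=> HP f Pf; apply/smoothP => n.
by elim: n f Pf => // n IH f /HP[df /IH].
Qed.

Lemma nderivable_cst n (c : R) : nderivable n (cst c).
Proof.
elim: n c => // n IH c; split; first by move=> x; exact: derivable_cst.
by rewrite (_ : derive1 _ = cst 0)//; apply/funext => x; rewrite derive1_cst.
Qed.

Lemma nderivableD n f g : nderivable n f -> nderivable n g ->
  nderivable n (fun x => f x + g x).
Proof.
elim: n f g => // n IH f g [df nf] [dg ng].
have [] := @derive1_is_derive (fun x => f x + g x) (fun x => derive1 f x + derive1 g x).
  by move=> x; apply: is_deriveD; exact: derivable_is_derive1.
by move=> ? E; split=> //; rewrite E; exact: IH.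
Qed.

Lemma derive1_mul f g x : derivable f x 1 -> derivable g x 1 ->
  is_derive x 1 (fun x => f x * g x) (derive1 f x * g x + f x * derive1 g x).
Proof.
move=> /derivable_is_derive1 df /derivable_is_derive1 dg.
rewrite addrC (mulrC (derive1 f x)); exact: (is_deriveM df dg).
Qed.

Lemma nderivableM n f g : nderivable n f -> nderivable n g ->
  nderivable n (fun x => f x * g x).
Proof.
elim: n f g => // n IH f g fn gn; have [df nf] := fn; have [dg ng] := gn.
have [] := @derive1_is_derive (fun x => f x * g x)
    (fun x => derive1 f x * g x + f x * derive1 g x).
  by move=> x; exact: derive1_mul.
move=> ? E; split=> //; rewrite E; apply: nderivableD; apply: IH => //;
  exact: nderivableS.
Qed.

Lemma derive1_affine f (a b : R) x : derivable f (a * x + b) 1 ->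
  is_derive x 1 (fun x => f (a * x + b)) (derive1 f (a * x + b) * a).
Proof.
move=> /derivable_is_derive1 df; apply: is_derive1_comp => //.
rewrite -[X in is_derive _ _ _ X]addr0; apply: is_deriveD.
by rewrite -[X in is_derive _ _ _ X]mulr1; apply: is_deriveZ.
Qed.

Lemma nderivable_affine n f (a b : R) : nderivable n f ->
  nderivable n (fun x => f (a * x + b)).
Proof.
elim: n f => // n IH f [df nf].
have [] := @derive1_is_derive (fun x => f (a * x + b))
    (fun x => derive1 f (a * x + b) * a).
  by move=> x; exact: derive1_affine.
move=> ? E; split=> //; rewrite E.
by apply: nderivableM; [exact: IH|exact: nderivable_cst].
Qed.

Lemma nderivableV n f : (forall x, f x != 0) -> nderivable n f ->
  nderivable n (fun x => (f x)^-1).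
Proof.
elim: n f => // n IH f f0 fn; have [df nf] := fn.
(* The derivative is written as a product containing [(f x)^-1] twice, so that the induction
   hypothesis applies to each of these factors. *)
have [] := @derive1_is_derive (fun x => (f x)^-1)
    (fun x => -1 * ((f x)^-1 * (f x)^-1) * derive1 f x).
  move=> x; have /derivable_is_derive1 dfx := df x.
  apply: (is_derive_eq (is_deriveV (f0 x) dfx)).
  by rewrite -[_ *: _]/(_ * _) -exprVn expr2 mulN1r.
move=> ? E; split=> //; rewrite E; apply: nderivableM => //.
apply: nderivableM; first exact: nderivable_cst.
by apply: nderivableM; apply: IH => //; exact: nderivableS.
Qed.

Lemma smoothD f g : smooth f -> smooth g -> smooth (fun x => f x + g x).
Proof. by move=> /smoothP sf /smoothP sg; apply/smoothP => n; exact: nderivableD. Qed.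

Lemma smoothM f g : smooth f -> smooth g -> smooth (fun x => f x * g x).
Proof. by move=> /smoothP sf /smoothP sg; apply/smoothP => n; exact: nderivableM. Qed.

Lemma smooth_affine f (a b : R) : smooth f -> smooth (fun x => f (a * x + b)).
Proof. by move=> /smoothP sf; apply/smoothP => n; exact: nderivable_affine. Qed.

Lemma smooth_cst (c : R) : smooth (cst c).
Proof. by apply/smoothP => n; exact: nderivable_cst. Qed.

Lemma smoothV f : (forall x, f x != 0) -> smooth f -> smooth (fun x => (f x)^-1).
Proof. by move=> f0 /smoothP sf; apply/smoothP => n; exact: nderivableV. Qed.

(** * Flat functions and a smooth transition from 0 to 1 *)

Lemma is_derive0_quadratic f (C : R) : f 0 = 0 ->
  (forall h, `|h| <= 1 -> `|f h| <= C * h ^+ 2) -> is_derive (0 : R) (1 : R) f 0.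
Proof.
move=> f0 fC.
have n0 : `|h| @[h --> (0 : R)^'] --> (0 : R).
  by rewrite -[X in _ --> X](normr0 R); apply: cvg_norm; exact: cvg_within.
have L : h^-1 *: ((f \o shift 0) (h *: 1) - f 0) @[h --> 0^'] --> (0 : R).
  apply: (@squeeze_cvgr _ _ _ _ (fun h : R => - (C * `|h|)) (fun h : R => C * `|h|)).
  - near=> h; rewrite -ler_norml /= f0 subr0 addr0.
    have h0 : h != 0 by near: h; exact: nbhs_dnbhs_neq.
    rewrite normrZ normfV [_ *: _]mulr1 mulrC ler_pdivrMr ?normr_gt0//.
    rewrite -mulrA -expr2 real_normK ?num_real//; apply: fC.
    by near: h; apply: dnbhs0_le.
  - rewrite -[X in _ --> X]oppr0; apply: cvgN; rewrite -[X in _ --> X](mulr0 C).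
    by apply: cvgM => //; exact: cvg_cst.
  - rewrite -[X in _ --> X](mulr0 C); apply: cvgM => //.
    exact: cvg_cst.
apply: DeriveDef; first by apply/cvg_ex; exists 0.
exact/cvg_lim.
Unshelve. all: by end_near. Qed.

(** The classical flat function exp(-1/x), with a polynomial factor in 1/x that makes the family
    closed under differentiation: [p] becomes X^2 (p - p'). *)
Definition flat_exp (p : {poly R}) x : R :=
  if 0 < x then p.[x^-1] * expR (- x^-1) else 0.

Lemma horner_norm_le (p : {poly R}) y : 1 <= y ->
  `|p.[y]| <= (\sum_(i < size p) `|p`_i|) * y ^+ size p.
Proof.
move=> y1; rewrite horner_coef mulr_suml (le_trans (ler_norm_sum _ _ _))//.
apply: ler_sum => i _; rewrite normrM ler_wpM2l//.
rewrite ger0_norm ?exprn_ge0 ?(le_trans ler01)//.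
by apply: ler_weXn2l => //; exact: ltnW.
Qed.

Lemma flat_exp_quadratic (p : {poly R}) :
  exists C, forall h, `|h| <= 1 -> `|flat_exp p h| <= C * h ^+ 2.
Proof.
(* With m = [size p] and y = 1/h >= 1, |p(y)| is at most the coefficient sum times y^m, while exp(y)
   >= y^(m+2) / (m+2)!; the quotient leaves (m+2)! h^2. *)
exists ((\sum_(i < size p) `|p`_i|) * ((size p).+2)`!%:R) => h h1.
have A0 : 0 <= \sum_(i < size p) `|p`_i| by apply: sumr_ge0.
rewrite /flat_exp; case: ifPn => [h0|_]; last first.
  by rewrite normr0 mulr_ge0 ?sqr_ge0// mulr_ge0.
set y := h^-1; have y1 : 1 <= y.
  by rewrite invf_ge1//; move: h1; rewrite gtr0_norm.
have y0 : 0 < y by rewrite invr_gt0.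
rewrite normrM (ger0_norm (expR_ge0 _)) -(invrK h) -/y exprVn.
rewrite ler_pdivlMr ?exprn_gt0//.
rewrite expRN mulrAC ler_pdivrMr ?expR_gt0//.
apply: (@le_trans _ _ ((\sum_(i < size p) `|p`_i|) * y ^+ (size p).+2)).
  rewrite [leRHS](_ : _ = (\sum_(i < size p) `|p`_i|) * y ^+ size p * y ^+ 2).
    by rewrite ler_wpM2r ?horner_norm_le// exprn_ge0// ltW.
  by rewrite -mulrA -exprD addn2.
rewrite -mulrA ler_wpM2l// mulrC -ler_pdivrMr ?ltr0n ?fact_gt0//.
by apply: le_trans (expR_ge1Dxn (size p).+1 (ltW y0)); rewrite lerDr.
Qed.

Lemma is_derive_flat_exp (p : {poly R}) x :
  is_derive x 1 (flat_exp p) (flat_exp ('X^2 * (p - p^`())) x).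
Proof.
have [x0|x0|->] := ltgtP x 0.
- rewrite {2}/flat_exp ltNge ltW//=.
  have d0 : is_derive x (1 : R) (cst 0 : R -> R) 0 by exact: is_derive_cst.
  apply: near_eq_is_derive d0.
  near=> y; rewrite /flat_exp ltNge ltW//=; near: y; exact: lt_nbhsl.
- rewrite {2}/flat_exp x0.
  have dV : is_derive x 1 (fun y : R => y^-1) (- x ^- 2 *: 1).
    by apply: is_deriveV => //; rewrite gt_eqF.
  have dp : is_derive x 1 (horner p \o (fun y => y^-1)) (p^`().[x^-1] * (- x ^- 2 *: 1)).
    exact: is_derive1_comp.
  have de : is_derive x 1 (expR \o (fun y => - y^-1)) (expR (- x^-1) * (- (- x ^- 2 *: 1))).
    apply: is_derive1_comp; exact: is_deriveN.
  have dpe : is_derive x 1 (fun y : R => p.[y^-1] * expR (- y^-1))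
      (('X^2 * (p - p^`())).[x^-1] * expR (- x^-1)).
    apply: (is_derive_eq (is_deriveM dp de)).
    rewrite !hornerE /= /GRing.scale/= mulr1.
    by rewrite -!exprVn; ring.
  apply: near_eq_is_derive dpe.
  near=> y; rewrite /flat_exp ifT//; near: y; exact: lt_nbhsr.
(* The origin is the only point near which no single formula is available; the quadratic bound makes
   the difference quotient there tend to 0. *)
- rewrite {2}/flat_exp ltxx; have [C hC] := flat_exp_quadratic p.
  by apply: is_derive0_quadratic hC; rewrite /flat_exp ltxx.
Unshelve. all: by end_near. Qed.

Lemma smooth_flat_exp (p : {poly R}) : smooth (flat_exp p).
Proof.
apply: (@smooth_coind (fun f => exists p, f = flat_exp p)); last by exists p.
move=> _ [q ->]; have [dq ->] := derive1_is_derive (is_derive_flat_exp q).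
by split=> //; eexists.
Qed.

(** The denominator never vanishes because x and 1 - x are not both nonpositive. The same function
    yields the cutoffs and the approximations of interval indicators. *)
Definition smooth_step x : R :=
  flat_exp 1 x / (flat_exp 1 x + flat_exp 1 (1 - x)).

Lemma flat_exp1_gt0 x : 0 < x -> 0 < flat_exp 1 x.
Proof. by move=> x0; rewrite /flat_exp x0 hornerC mul1r expR_gt0. Qed.

Lemma flat_exp1_ge0 x : 0 <= flat_exp 1 x.
Proof. by have [/flat_exp1_gt0/ltW//|x0] := ltP 0 x; rewrite /flat_exp ltNge x0. Qed.

Lemma smooth_step_den_gt0 x : 0 < flat_exp 1 x + flat_exp 1 (1 - x).
Proof.
have [x0|x0] := ltP 0 x; first by rewrite ltr_wpDr ?flat_exp1_ge0 ?flat_exp1_gt0.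
rewrite ltr_wpDl ?flat_exp1_ge0 ?flat_exp1_gt0// subr_gt0.
by rewrite (le_lt_trans x0).
Qed.

Lemma smooth_smooth_step : smooth smooth_step.
Proof.
have s1 : smooth (fun x => flat_exp 1 (1 - x)).
  have := @smooth_affine _ (-1) 1 (@smooth_flat_exp 1).
  by under eq_fun do rewrite mulN1r addrC.
apply: smoothM; first exact: smooth_flat_exp.
apply: smoothV; first by move=> x; rewrite gt_eqF// smooth_step_den_gt0.
by apply: smoothD; [exact: smooth_flat_exp|exact: s1].
Qed.

Lemma smooth_step_le0 x : x <= 0 -> smooth_step x = 0.
Proof. by move=> x0; rewrite /smooth_step {1}/flat_exp ltNge x0 mul0r. Qed.

Lemma smooth_step_ge1 x : 1 <= x -> smooth_step x = 1.
Proof.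
move=> x1; rewrite /smooth_step [X in _ + X](_ : _ = 0) ?addr0 ?divff//.
  by rewrite gt_eqF// flat_exp1_gt0// (lt_le_trans ltr01).
by rewrite /flat_exp ltNge subr_le0 x1.
Qed.

Lemma smooth_step_ge0_le1 x : 0 <= smooth_step x <= 1.
Proof.
have d0 := smooth_step_den_gt0 x.
rewrite divr_ge0 ?flat_exp1_ge0 ?(ltW d0)//=.
by rewrite ler_pdivrMr ?smooth_step_den_gt0// mul1r lerDl flat_exp1_ge0.
Qed.

Lemma derive1_outside_itv f (c a b : R) : (forall x, x \notin `[a, b] -> f x = c) ->
  forall x, x \notin `[a, b] -> derive1 f x = 0.
Proof.
move=> fc x; rewrite in_itv/= negb_and -!ltNge => xab.
rewrite derive1E; suff : is_derive x (1 : R) f 0 by case.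
have d0 : is_derive x (1 : R) (cst c : R -> R) 0 by exact: is_derive_cst.
apply: near_eq_is_derive d0.
case/orP : xab => xab; near=> y; rewrite fc// in_itv/= negb_and -!ltNge.
  by apply/orP; left; near: y; exact: lt_nbhsl.
by apply/orP; right; near: y; exact: lt_nbhsr.
Unshelve. all: by end_near. Qed.

Lemma continuous_itv_support_bounded f (a b : R) : continuous f ->
  (forall x, x \notin `[a, b] -> f x = 0) -> exists2 B, 0 <= B & forall x, `|f x| <= B.
Proof.
move=> cf f0.
have /compact_bounded[B0 [_ HB]] : compact (f @` `[a, b]).
  apply: continuous_compact; last exact: segment_compact.
  exact: continuous_subspaceT.
pose B := `|B0| + 1; have B0B : B0 < B by rewrite (le_lt_trans (ler_norm _))// ltrDl.
have Bge0 : 0 <= B by rewrite addr_ge0.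
exists B => // x; have [xab|xab] := boolP (x \in `[a, b]); last by rewrite f0// normr0.
by apply: HB B0B _ _; exists x.
Qed.

End smooth_functions.

(** * Fractional integrals *)

(* Both fractional integrals at once: [e = 1] for [Minus], [e = -1] for [Plus]. *)
Definition fracJ {R : realType} (e s : R) (f : R -> R) (x : R) : R :=
  \int[@lebesgue_measure R]_t (f (x - e * t) * fkernel s t).

Section fractional_integral.
Context {R : realType}.
Local Notation mu := (@lebesgue_measure R).
Local Notation TR := (measurableTypeR R).
Implicit Types (e s t x : R) (f g v : R -> R).

(** The extended integral of a measurable function is finite only if the function is integrable, and
    [fine] sends every infinite value to 0. *)
Lemma integrable_Rintegral_notin d (T : measurableType d)
    (m : {measure set T -> \bar R}) (D : set T) (f : T -> R) :
  measurable D -> measurable_fun D f -> ~ m.-integrable D (EFin \o f) ->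
  \int[m]_(x in D) f x = 0.
Proof.
move=> mD mf nf; rewrite /Rintegral.
have : ~~ (\int[m]_(x in D) (f x)%:E \is a fin_num)%E.
  rewrite -integral_fin_num_abs//; apply/negP => fi; apply: nf.
  by apply/integrableP; split => //; exact/measurable_EFinP.
by case: (\int[m]_(x in D) (f x)%:E)%E.
Qed.

(** For a nonzero factor, divergence on one side means divergence on the other, and both sides then
    take the default value 0. Hence [fracI] and [fracJ] agree at every point, even where the
    defining integral diverges. *)
Lemma measurable_RintegralZl d (T : measurableType d)
    (m : {measure set T -> \bar R}) (D : set T) (f : T -> R) (c : R) :
  measurable D -> measurable_fun D f ->
  \int[m]_(x in D) (c * f x) = c * \int[m]_(x in D) f x.
Proof.
move=> mD mf; have [->|c0] := eqVneq c 0.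
  rewrite mul0r /Rintegral integral0_eq// => x _.
  by rewrite mul0r.
have [fi|nfi] := pselect (m.-integrable D (EFin \o f)); first exact: RintegralZl.
rewrite (integrable_Rintegral_notin mD mf nfi) mulr0.
apply: integrable_Rintegral_notin => //; first exact: measurable_funM.
move=> cfi; apply: nfi.
have := integrableZl mD c^-1 cfi; apply: eq_integrable => // x _.
by rewrite /= -EFinM mulrA mulVf// mul1r.
Qed.

Lemma fracI_MinusE s f x : measurable_fun setT f -> fracI Minus s f x = fracJ 1 s f x.
Proof.
move=> mf; rewrite /fracI.
have mg : measurable_fun setT (fun y : R => f y * (x - y) `^ (s - 1)).
  apply: measurable_funM => //.
  apply: (@measurableT_comp _ _ _ _ _ _ (fun t : R => t `^ (s - 1))).
    exact: measurable_powR.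
  exact: measurable_funB.
rewrite -measurable_RintegralZl//; last first.
  apply: measurable_funTS; apply: eq_measurable_fun mg => y _.
  by rewrite -powRN opprB.
rewrite Rintegral_mkcond /fracJ /Rintegral; congr fine.
rewrite -(@integral_affine _ (-1) x) ?normrN1//; last first.
  apply/measurable_EFinP; apply/(measurable_restrictT _ _).1 => //.
  apply: measurable_funTS; apply: measurable_funM => //.
  by apply: eq_measurable_fun mg => y _; rewrite -powRN opprB.
apply: eq_integral => t _; congr (_%:E).
rewrite patchE mem_setE in_itv/= mulN1r addrC gtrBl /fkernel mul1r.
case: ifP => // _; last by rewrite mulr0.
by rewrite subKr -powRN opprB; ring.
Qed.

Lemma fracI_PlusE s f x : measurable_fun setT f -> fracI Plus s f x = fracJ (-1) s f x.
Proof.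
move=> mf; rewrite /fracI.
have mg : measurable_fun setT (fun y : R => f y * (y - x) `^ (s - 1)).
  apply: measurable_funM => //.
  apply: (@measurableT_comp _ _ _ _ _ _ (fun t : R => t `^ (s - 1))).
    exact: measurable_powR.
  exact: measurable_funB.
rewrite -measurable_RintegralZl//; last first.
  apply: measurable_funTS; apply: eq_measurable_fun mg => y _.
  by rewrite -powRN opprB.
rewrite Rintegral_mkcond /fracJ /Rintegral; congr fine.
rewrite -(@integral_affine _ 1 x) ?normr1//; last first.
  apply/measurable_EFinP; apply/(measurable_restrictT _ _).1 => //.
  apply: measurable_funTS; apply: measurable_funM => //.
  by apply: eq_measurable_fun mg => y _; rewrite -powRN opprB.
apply: eq_integral => t _; congr (_%:E).
rewrite patchE mem_setE in_itv/= andbT mul1r ltrDr /fkernel mulN1r opprK addrC.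
case: ifP => // _; last by rewrite mulr0.
by rewrite addrC addrK -powRN opprB addrC; ring.
Qed.

Lemma measurable_shift_fkernel e s f x : measurable_fun setT f ->
  measurable_fun setT (fun t : TR => f (x - e * t) * fkernel s t).
Proof.
move=> mf; apply: measurable_funM; last exact: measurable_fkernel.
by apply: measurableT_comp => //; apply: measurable_funB => //; exact: measurable_funM.
Qed.

(** The value is 1 / (s Gamma(s)), but only its finiteness, its sign and the scaling by [T ^ s]
    matter. *)
Definition fkernel_mass s : R := \int[mu]_(t in `]0, 1]) fkernel s t.

Lemma integral_fkernel s T : 0 < s <= 1 -> 0 < T ->
  (\int[mu]_(t in `]0%R, T]) (fkernel s t)%:E = (T `^ s * fkernel_mass s)%:E)%E.
Proof.
move=> s01 T0; have /andP[s0 s1] := s01.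
have mk : measurable_fun setT (fun t => (fkernel s t)%:E).
  by apply/measurable_EFinP; exact: measurable_fkernel.
have E1 : (\int[mu]_(t in `]0%R, 1%R]) (fkernel s t)%:E = (fkernel_mass s)%:E)%E.
  rewrite fineK// ge0_fin_numE; last first.
    by apply: integral_ge0 => t _; rewrite lee_fin fkernel_ge0.
  rewrite [ltLHS](_ : _ = (\int[mu]_(t in `]0%R, 1%R])
      (((Gamma s)^-1)%:E * (t `^ (s - 1))%R%:E))%E); last first.
    apply: eq_integral => t; rewrite inE/= in_itv/= => /andP[t0 _].
    by rewrite /fkernel t0 -EFinM mulrC.
  rewrite ge0_integralZl//.
  - rewrite lte_mul_pinfty ?integral_powR_lty// lee_fin invr_ge0 ltW//.
    exact: Gamma_gt0.
  - by apply/measurable_EFinP; apply: measurable_funTS; exact: measurable_powR.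
  - by move=> t _; rewrite lee_fin powR_ge0.
  - by rewrite lee_fin invr_ge0 ltW// Gamma_gt0.
rewrite integral_mkcond (ge0_integral_affine 0 (lt0r_neq0 T0)); last 2 first.
- by apply/(measurable_restrictT _ _).1 => //; exact: measurable_funTS.
- by move=> t; rewrite patchE; case: ifP => // _; rewrite lee_fin fkernel_ge0.
rewrite EFinM -E1 -(mulr_powRB1 (ltW T0) s0) EFinM -muleA gtr0_norm//; congr (_ * _)%E.
rewrite -ge0_integralZl//.
- rewrite [RHS]integral_mkcond; apply: eq_integral => t _.
  rewrite !patchE !mem_setE !in_itv/= addr0 pmulr_rgt0// -ler_pdivlMl// mulVf ?gt_eqF//.
  by case: ifP => // _; rewrite fkernelM// EFinM.
- exact: measurable_funTS.
- by move=> t _; rewrite lee_fin fkernel_ge0.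
- by rewrite lee_fin powR_ge0.
Qed.

Lemma fkernel_nonincreasing s t T : 0 < s <= 1 -> 0 < T -> T <= t ->
  fkernel s t <= fkernel s T.
Proof.
move=> s01 T0 Tt; have t0 : 0 < t by exact: lt_le_trans Tt.
rewrite /fkernel T0 t0; apply: ler_wpM2r; first by rewrite invr_ge0 ltW// Gamma_gt0.
have /andP[_ s1] := s01.
rewrite -(opprB 1 s) !powRN lef_pV2 ?posrE ?powR_gt0//.
by apply: ge0_ler_powR; rewrite ?nnegrE ?subr_ge0// ltW.
Qed.

(** On []0, T]] the function is bounded by [B] and the kernel is integrated; beyond [T] the kernel
    is at most its value at [T] and the function is integrated. [T] is left free: 1 suffices for
    convergence, while the cutoff error needs it to grow. *)
Lemma shift_fkernel_le e s f (B N T : R) x : `|e| = 1 -> 0 < s <= 1 -> 0 < T ->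
  measurable_fun setT f -> (forall y, `|f y| <= B) ->
  (\int[mu]_y `|f y|%:E <= N%:E)%E ->
  (\int[mu]_t `|f (x - e * t)%R * fkernel s t|%:E <=
   (B * (T `^ s * fkernel_mass s) + fkernel s T * N)%:E)%E.
Proof.
move=> e1 s01 T0 mf fB fN.
have B0 : 0 <= B by rewrite (le_trans _ (fB 0)).
have mk : measurable_fun setT (fun t => (fkernel s t)%:E).
  by apply/measurable_EFinP; exact: measurable_fkernel.
have mkT : measurable_fun setT ((fun t => (fkernel s t)%:E) \_ `]0, T]%classic).
  by apply/(measurable_restrictT _ _).1 => //; exact: measurable_funTS.
have kT0 t : (0 <= ((fun t => (fkernel s t)%:E) \_ `]0%R, T]%classic) t)%E.
  by rewrite patchE; case: ifP => // _; rewrite lee_fin fkernel_ge0.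
have mfe : measurable_fun setT (fun t : R => `|f (x - e * t)|%:E).
  apply/measurable_EFinP; apply: measurableT_comp => //; apply: measurableT_comp => //.
  by apply: measurable_funB => //; exact: measurable_funM.
pose G (t : R) : \bar R := (B%:E * ((fun t => (fkernel s t)%:E) \_ `]0%R, T]%classic) t +
  (fkernel s T)%:E * `|f (x - e * t)%R|%:E)%E.
apply: (@le_trans _ _ (\int[mu]_t G t)%E).
  apply: ge0_le_integral => //.
  - apply/measurable_EFinP; apply: measurableT_comp => //.
    exact: measurable_shift_fkernel.
  - apply: emeasurable_funD; first exact: measurable_funeM.
    exact: measurable_funeM.
  - move=> t _; rewrite /G patchE mem_setE in_itv/= normrM (ger0_norm (fkernel_ge0 _ s01)).
    have [t0|t0] /= := ltP 0 t; last first.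
      by rewrite fkernel_le0// mulr0 adde_ge0// ?mule_ge0 ?lee_fin ?fkernel_ge0.
    case: ifPn => [tT|]; last first.
      rewrite -ltNge => Tt; rewrite mule0 add0e -EFinM lee_fin mulrC ler_wpM2r//.
      by apply: fkernel_nonincreasing => //; exact: ltW.
    by rewrite -!EFinM -EFinD lee_fin ler_wpDr ?mulr_ge0 ?ler_wpM2r ?fkernel_ge0.
rewrite ge0_integralD//; last 4 first.
- by move=> t _; rewrite mule_ge0 ?lee_fin.
- exact: measurable_funeM.
- by move=> t _; rewrite mule_ge0 ?lee_fin ?fkernel_ge0.
- exact: measurable_funeM.
rewrite ge0_integralZl// ?lee_fin// ge0_integralZl// ?lee_fin ?fkernel_ge0//.
rewrite -integral_mkcond integral_fkernel// EFinD -EFinM leeD2l// EFinM.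
rewrite lee_wpmul2l ?lee_fin ?fkernel_ge0//.
rewrite (_ : \int[mu]_t _ = \int[mu]_y `|f y|%:E)%E//.
rewrite -[RHS](@integral_affine _ (- e) x) ?normrN//.
  by apply: eq_integral => t _; rewrite mulNr addrC.
by apply/measurable_EFinP; exact: measurableT_comp.
Qed.

Lemma integrable_shift_fkernel e s f (B N : R) x : `|e| = 1 -> 0 < s <= 1 ->
  measurable_fun setT f -> (forall y, `|f y| <= B) ->
  (\int[mu]_y `|f y|%:E <= N%:E)%E ->
  mu.-integrable setT (fun t => (f (x - e * t) * fkernel s t)%:E).
Proof.
move=> e1 s01 mf fB fN; apply/integrableP; split.
  by apply/measurable_EFinP; exact: measurable_shift_fkernel.
by rewrite (le_lt_trans (shift_fkernel_le x e1 s01 ltr01 mf fB fN))// ltry.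
Qed.

Lemma fracJ_abs_le e s f (B N T : R) x : `|e| = 1 -> 0 < s <= 1 -> 0 < T ->
  measurable_fun setT f -> (forall y, `|f y| <= B) ->
  (\int[mu]_y `|f y|%:E <= N%:E)%E ->
  `|fracJ e s f x| <= B * (T `^ s * fkernel_mass s) + fkernel s T * N.
Proof.
move=> e1 s01 T0 mf fB fN; have fi := integrable_shift_fkernel x e1 s01 mf fB fN.
rewrite -lee_fin (le_trans _ (shift_fkernel_le x e1 s01 T0 mf fB fN))//.
by rewrite EFin_normr_Rintegral// le_abse_integral//; exact: measurable_int fi.
Qed.

End fractional_integral.

(** * Differentiating fractional integrals *)

Section fractional_integral_calculus.
Context {R : realType}.
Local Notation mu := (@lebesgue_measure R).
Local Notation TR := (measurableTypeR R).
Implicit Types (e s t x : R) (f g v : R -> R).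

Lemma itv_support_bounds f (a b : R) : continuous f ->
  (forall x, x \notin `[a, b] -> f x = 0) ->
  exists B : R, exists N : R, [/\ 0 <= B, 0 <= N, (forall x, `|f x| <= B) &
    (\int[mu]_y `|f y|%:E <= N%:E)%E].
Proof.
move=> cf f0; have [B B0 fB] := continuous_itv_support_bounded cf f0.
have fi : mu.-integrable setT (EFin \o f).
  have : mu.-integrable `[a, b] (EFin \o f).
    apply: continuous_compact_integrable; first exact: segment_compact.
    exact: continuous_subspaceT.
  rewrite integrable_mkcond//; apply: eq_integrable => // x _.
  rewrite patchE; case: ifPn => //; rewrite mem_setE => xab.
  by rewrite /= f0.
exists B, (fine (\int[mu]_y `|f y|%:E)%E); split => //.
  by rewrite fine_ge0// integral_ge0.
rewrite fineK// ge0_fin_numE ?integral_ge0//.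
by have /integrableP[] := fi.
Qed.

Lemma is_derive_shift_fkernel e s f (x t : R) : (forall y, derivable f y 1) ->
  is_derive x 1 (fun z => f (z - e * t) * fkernel s t)
    (derive1 f (x - e * t) * fkernel s t).
Proof.
move=> df.
have dc : is_derive x 1 (fun z => f (1 * z + - (e * t)))
    (derive1 f (1 * x + - (e * t)) * 1) by exact: derive1_affine.
rewrite (_ : (fun z => _) = (fkernel s t \*: (fun z => f (1 * z + - (e * t))))).
  apply: (is_derive_eq (is_deriveZ (fkernel s t) dc)).
  by rewrite mul1r mulr1 -[LHS]/(_ * _) mulrC.
by apply/funext => z; rewrite /= mul1r -[RHS]/(_ * _) mulrC.
Qed.

(** In convolution form the variable occurs only in the smooth factor, so the singular kernel is
    never differentiated and a local dominating function suffices. *)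
Lemma is_derive_fracJ e s f (M : R) x : `|e| = 1 -> 0 < s <= 1 ->
  (forall y, derivable f y 1) -> continuous (derive1 f) ->
  (forall y, y \notin `[- M, M] -> f y = 0) ->
  is_derive x 1 (fracJ e s f) (fracJ e s (derive1 f) x).
Proof.
move=> e1 s01 df cdf f0; have cf := derivable_continuous df.
have mf : measurable_fun setT f by exact: continuous_measurable_fun.
have df0 := derive1_outside_itv f0.
have [B0 [N0 [B00 _ fB0 fN0]]] := itv_support_bounds cf f0.
have [B [_ [Bge0 _ fB _]]] := itv_support_bounds cdf df0.
(* For |z - x| < 1 and t > T the point z - e t lies outside the support, so the derivative of the
   integrand is dominated by [B] times the kernel on []0, T]]. *)
pose T : R := `|M| + `|x| + 1.
have T0 : 0 < T by rewrite ltr_pwDr// addr_ge0.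
pose G (t : R) : R := B * (fkernel s \_ `]0, T]) t.
have G0 t : 0 <= G t.
  by rewrite mulr_ge0// patchE; case: ifP => // _; rewrite fkernel_ge0.
have iG : mu.-integrable setT (EFin \o G).
  apply/integrableP; split.
    apply/measurable_EFinP; apply: measurable_funM => //.
    apply/(measurable_restrictT _ _).1 => //; apply: measurable_funTS.
    exact: measurable_fkernel.
  rewrite (_ : (\int[mu]_t _ = B%:E * \int[mu]_(t in `]0%R, T]) (fkernel s t)%:E)%E).
    by rewrite integral_fkernel// -EFinM ltry.
  rewrite [X in (_ * X)%E]integral_mkcond -ge0_integralZl//.
  - apply: eq_integral => t _; rewrite gee0_abs ?lee_fin//= EFinM.
    by congr (_ * _)%E; rewrite !patchE; case: ifP.
  - apply/(measurable_restrictT _ _).1 => //; apply: measurable_funTS.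
    by apply/measurable_EFinP; exact: measurable_fkernel.
  - by move=> t _; rewrite patchE; case: ifP => // _; rewrite lee_fin fkernel_ge0.
have Ix : `]x - 1, x + 1[%classic x by rewrite /= in_itv/= gtrBl ltrDl ltr01.
have int1 (z : R) : `]x - 1, x + 1[%classic z ->
    mu.-integrable setT (EFin \o (fun t => f (z - e * t) * fkernel s t)).
  by move=> _; exact: integrable_shift_fkernel e1 s01 mf fB0 fN0.
have der1 (z : R) (t : TR) : `]x - 1, x + 1[%classic z -> setT t ->
    derivable ((fun z (t : TR) => f (z - e * t) * fkernel s t)^~ t) z 1.
  by move=> _ _; have [] := is_derive_shift_fkernel e s z t df.
have d1E z t : partial1of2 (fun z (t : TR) => f (z - e * t) * fkernel s t) z t =
    derive1 f (z - e * t) * fkernel s t.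
  rewrite /partial1of2 derive1E.
  by have [] := is_derive_shift_fkernel e s z t df.
have d1G (z : R) (t : TR) : `]x - 1, x + 1[%classic z -> setT t ->
    `|partial1of2 (fun z (t : TR) => f (z - e * t) * fkernel s t) z t| <= G t.
  rewrite /= in_itv/= => /andP[zx xz] _; rewrite d1E /G patchE mem_setE in_itv/=.
  have [t0|t0] /= := ltP 0 t; last by rewrite fkernel_le0// mulr0 normr0 mulr0.
  rewrite normrM (ger0_norm (fkernel_ge0 _ s01)).
  have [tT|Tt] := leP t T; first by rewrite ler_wpM2r// fkernel_ge0.
  rewrite df0 ?normr0 ?mul0r ?mulr0//; apply/negP; rewrite in_itv/= -ler_norml => zM.
  have : `|e * t| <= `|z - e * t| + `|z|.
    by rewrite -{1}(subKr z (e * t)) [leRHS]addrC ler_normB.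
  rewrite normrM e1 mul1r (gtr0_norm t0) leNgt => /negP; apply.
  rewrite (le_lt_trans _ Tt)// /T -addrA lerD//.
    by rewrite (le_trans zM)// ler_norm.
  rewrite -{1}(subrK x z) (le_trans (ler_normD _ _))// addrC lerD//.
  by rewrite ler_norml; apply/andP; split; lra.
have dJ := derivable_under_integral measurableT Ix int1 der1 G0 iG d1G.
have := differentiation_under_integral measurableT Ix int1 der1 G0 iG d1G.
rewrite derive1E => EJ; apply: DeriveDef; first exact: dJ.
rewrite [LHS]EJ /fracJ; apply: eq_Rintegral => t _; exact: d1E.
Qed.

Lemma integral_derive1_support e f (M : R) x : `|e| = 1 ->
  (forall y, derivable f y 1) -> continuous (derive1 f) ->
  (forall y, y \notin `[- M, M] -> f y = 0) ->
  (\int[mu]_(q in `]0%R, +oo[) (derive1 f (x - e * q))%:E = (e * f x)%:E)%E.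
Proof.
move=> e1 df cdf f0; have df0 := derive1_outside_itv f0.
have ee : e * e = 1 by rewrite -expr2 -real_normK ?num_real// e1 expr1n.
pose T : R := `|M| + `|x| + 1.
have T0 : 0 < T by rewrite ltr_pwDr// addr_ge0.
have out (q : R) : T <= q -> x - e * q \notin `[- M, M].
  move=> Tq; apply/negP; rewrite in_itv/= -ler_norml => xM.
  have q0 : 0 < q by exact: lt_le_trans Tq.
  have : `|e * q| <= `|x - e * q| + `|x|.
    by rewrite -{1}(subKr x (e * q)) [leRHS]addrC ler_normB.
  rewrite normrM e1 mul1r (gtr0_norm q0) leNgt => /negP; apply.
  by rewrite (lt_le_trans _ Tq)// ltr_pwDr// lerD2r (le_trans xM)// ler_norm.
have cq : continuous (fun q : R => derive1 f (x - e * q)).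
  move=> q; apply: continuous_comp; last exact: cdf.
  by apply: cvgB; [exact: cvg_cst|apply: cvgM; [exact: cvg_cst|exact: cvg_id]].
(* As e^2 = 1, the map q -> - e f(x - e q) is a primitive; it vanishes at [T], and its value at 0
   yields e f(x). *)
have dF (q : R) : is_derive q (1 : R) (fun q : R => - e * f (x - e * q))
    (derive1 f (x - e * q)).
  have dc : is_derive q (1 : R) (fun q : R => f (- e * q + x))
      (derive1 f (- e * q + x) * - e) by exact: derive1_affine.
  rewrite (_ : (fun q : R => _) = (- e \*: (fun q : R => f (- e * q + x)))).
    apply: (is_derive_eq (is_deriveZ (- e) dc)).
    by rewrite -[LHS]/(_ * _) mulrCA mulrNN ee mulr1 mulNr addrC.
  by apply/funext => z; rewrite /= -[RHS]/(_ * _) (mulNr e z) addrC.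
have [ddF EdF] := derive1_is_derive dF.
have cF := derivable_continuous ddF.
have mq : measurable_fun setT (fun q : R => (derive1 f (x - e * q))%:E).
  by apply/measurable_EFinP; exact: continuous_measurable_fun cq.
rewrite integral_itv_obnd_cbnd; last exact: measurable_funTS.
transitivity (\int[mu]_(q in `[0%R, T]) (derive1 f (x - e * q))%:E)%E.
  rewrite integral_mkcond [RHS]integral_mkcond; apply: eq_integral => q _.
  rewrite !patchE !mem_setE !in_itv/= andbT; case: (leP 0 q) => //= q0.
  by case: (leP q T) => // Tq; rewrite df0// out// ltW.
rewrite (continuous_FTC2 T0 _ (F := fun q : R => - e * f (x - e * q))).
- by rewrite -EFinB (f0 (x - e * T)) ?out// !mulr0 subr0 sub0r mulNr opprK.
- exact: continuous_subspaceT.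
- split.
  + by move=> q _; exact: ddF.
  + by apply: cvg_at_right_filter; exact: cF.
  + by apply: cvg_at_left_filter; exact: cF.
- by move=> q _; rewrite EdF.
Unshelve. all: by end_near. Qed.

End fractional_integral_calculus.

(** * Duality and semigroup property *)

Section fractional_duality.
Context {R : realType}.
Local Notation mu := (@lebesgue_measure R).
Local Notation TR := (measurableTypeR R).
Implicit Types (e s t x : R) (f g v : R -> R).

Lemma measurable_fracJ_kernel2 e s v g : measurable_fun setT v ->
  measurable_fun setT g ->
  measurable_fun setT (fun z : TR * TR => v (z.1 - e * z.2) * fkernel s z.2 * g z.1).
Proof.
move=> mv mg; apply: measurable_funM; last first.
  by apply: measurableT_comp => //; exact: measurable_fst.
apply: measurable_funM; last first.
  by apply: measurableT_comp; [exact: measurable_fkernel|exact: measurable_snd].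
have := measurable_linear2 1 (- e) mv.
by apply: eq_measurable_fun => z _; rewrite mul1r mulNr.
Qed.

(** Without integrability, the inner integral is still the difference of the partial integrals of
    the positive and negative parts, each measurable by Tonelli, and [fine] is measurable. *)
Lemma measurable_fracJ e s f : measurable_fun setT f ->
  measurable_fun setT (fracJ e s f).
Proof.
move=> mf.
pose F (z : TR * TR) := (f (z.1 - e * z.2) * fkernel s z.2)%:E.
have mF : measurable_fun setT F.
  apply/measurable_EFinP.
  have := measurable_fracJ_kernel2 e s mf (measurable_cst (1 : R)).
  by apply: eq_measurable_fun => z _; rewrite mulr1.
have mI : measurable_fun setT (fun x : TR => \int[mu]_t F (x, t))%E.
  rewrite (_ : (fun x => _) = (fun x : TR =>
      (\int[mu]_t F^\+ (x, t) - \int[mu]_t F^\- (x, t))%E)); last first.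
    apply/funext => x; rewrite integralE; congr (_ - _)%E; apply: eq_integral => t _.
      by rewrite !funeposE.
    by rewrite !funenegE.
  apply: emeasurable_funB.
    apply: (@measurable_fun_fubini_tonelli_F _ _ _ _ _ mu F^\+%E) => //.
    exact: measurable_funepos.
  apply: (@measurable_fun_fubini_tonelli_F _ _ _ _ _ mu F^\-%E) => //.
  exact: measurable_funeneg.
by apply: (measurableT_comp _ mI); exact: fine_measurable.
Qed.

Lemma integral_fracJ e s v g : measurable_fun setT v -> measurable_fun setT g ->
  (mu \x mu)%E.-integrable setT
    (fun z : TR * TR => (v (z.1 - e * z.2) * fkernel s z.2 * g z.1)%:E) ->
  mu.-integrable setT (fun x => (fracJ e s v x * g x)%:E) /\
  (\int[mu]_x \int[mu]_t (v (x - e * t) * fkernel s t * g x)%:E =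
   \int[mu]_x (fracJ e s v x * g x)%:E)%E.
Proof.
move=> mv mg iH.
have mJ : measurable_fun setT (fun x => (fracJ e s v x * g x)%:E).
  by apply/measurable_EFinP/measurable_funM => //; exact: measurable_fracJ.
have ae : \forall x \ae mu, setT x ->
    (fubini_F mu (fun z : TR * TR => (v (z.1 - e * z.2) * fkernel s z.2 * g z.1)%:E) x
     = (fracJ e s v x * g x)%:E)%E.
  have := ae_integrable1 iH; apply: filterS => x /= iHx _.
  (* Where [g x] is nonzero, dividing by it shows that the section is integrable, so [fracJ] has its
     genuine value; where [g x] is zero both sides vanish whatever [fracJ] is. *)
  rewrite /fubini_F /=; have [gx0|gx0] := eqVneq (g x) 0.
    by rewrite gx0 mulr0 integral0_eq// => t _; rewrite mulr0.
  have ivk : mu.-integrable setT (fun t => (v (x - e * t) * fkernel s t)%:E).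
    have := integrableZl measurableT (g x)^-1 iHx.
    apply: eq_integrable => // t _.
    by rewrite -EFinM mulrC mulfK.
  under eq_integral do rewrite EFinM.
  rewrite integralZr//= /fracJ EFinM fineK//.
  exact: integrable_fin_num ivk.
have iF := integrable_fubini_F iH.
split; last by apply: ae_eq_integral => //; exact: measurable_int iF.
apply/integrableP; split => //.
rewrite (_ : (\int[mu]_x _)%E = (\int[mu]_x `|fubini_F mu
  (fun z : TR * TR => (v (z.1 - e * z.2) * fkernel s z.2 * g z.1)%:E) x|)%E).
  by have /integrableP[] := iF.
apply: ae_eq_integral => //.
- exact: measurableT_comp.
- by apply: measurableT_comp => //; exact: measurable_int iF.
- by move: ae; apply: filterS => x /= /[apply] ->.
Qed.

(** The source of the adjunction: for fixed t, the translation x -> x + e t moves the shift from [v]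
    to [g] and reverses its sign. *)
Lemma integral_fracJ_shift e s v g t : measurable_fun setT v -> measurable_fun setT g ->
  (\int[mu]_x (v (x - e * t) * fkernel s t * g x)%:E =
   \int[mu]_x (g (x - (- e) * t) * fkernel s t * v x)%:E)%E.
Proof.
move=> mv mg; rewrite -(@integral_affine _ 1 (e * t)) ?normr1//; last first.
  apply/measurable_EFinP; apply: measurable_funM => //; apply: measurable_funM => //.
  by apply: measurableT_comp => //; exact: measurable_funB.
apply: eq_integral => x _; congr (_%:E).
by rewrite mul1r addrK mulNr opprK mulrAC [v x * _]mulrC mulrAC.
Qed.

Lemma ge0_fracJ_duality e s v g : 0 < s <= 1 ->
  measurable_fun setT v -> measurable_fun setT g ->
  (forall x, 0 <= v x) -> (forall x, 0 <= g x) ->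
  (\int[mu]_x \int[mu]_t (v (x - e * t) * fkernel s t * g x)%:E =
   \int[mu]_x \int[mu]_t (g (x - (- e) * t) * fkernel s t * v x)%:E)%E.
Proof.
move=> s01 mv mg v0 g0.
rewrite (fubini_tonelli (fun z : TR * TR =>
  (v (z.1 - e * z.2) * fkernel s z.2 * g z.1)%:E)); last 2 first.
- by apply/measurable_EFinP; exact: measurable_fracJ_kernel2.
- by move=> z; rewrite lee_fin !mulr_ge0// fkernel_ge0.
rewrite [RHS](fubini_tonelli (fun z : TR * TR =>
  (g (z.1 - (- e) * z.2) * fkernel s z.2 * v z.1)%:E)); last 2 first.
- by apply/measurable_EFinP; exact: measurable_fracJ_kernel2.
- by move=> z; rewrite lee_fin !mulr_ge0// fkernel_ge0.
apply: eq_integral => t _.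
exact: integral_fracJ_shift.
Qed.

(** Nonnegative duality for [|v|] and [|g|] carries the single absolute-convergence hypothesis over
    to the other side, so Fubini applies to both double integrals. *)
Lemma fracJ_duality e s v g : 0 < s <= 1 ->
  measurable_fun setT v -> measurable_fun setT g ->
  (\int[mu]_x \int[mu]_t (`|g (x - (- e) * t)%R| * fkernel s t * `|v x|)%:E < +oo)%E ->
  mu.-integrable setT (fun x => (fracJ e s v x * g x)%:E) /\
  \int[mu]_x (fracJ e s v x * g x) = \int[mu]_x (fracJ (- e) s g x * v x).
Proof.
move=> s01 mv mg fin.
have absE (w h : R -> R) (a : R) :
    (\int[mu]_x \int[mu]_t `|(w (x - a * t)%R * fkernel s t * h x)%:E| =
     \int[mu]_x \int[mu]_t (`|w (x - a * t)%R| * fkernel s t * `|h x|)%:E)%E.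
  apply: eq_integral => x _; apply: eq_integral => t _.
  by rewrite /= !normrM (ger0_norm (fkernel_ge0 _ s01)).
have iH1 : (mu \x mu)%E.-integrable setT
    (fun z : TR * TR => (v (z.1 - e * z.2) * fkernel s z.2 * g z.1)%:E).
  apply/integrable12ltyP.
    by apply/measurable_EFinP; exact: measurable_fracJ_kernel2.
  rewrite /= absE.
  by rewrite (@ge0_fracJ_duality e s (fun x => `|v x|) (fun x => `|g x|))//;
    exact: measurableT_comp.
have iH2 : (mu \x mu)%E.-integrable setT
    (fun z : TR * TR => (g (z.1 - (- e) * z.2) * fkernel s z.2 * v z.1)%:E).
  apply/integrable12ltyP; last by rewrite /= absE.
  by apply/measurable_EFinP; exact: measurable_fracJ_kernel2.
have [iJ1 E1] := integral_fracJ mv mg iH1.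
have [_ E2] := integral_fracJ mg mv iH2.
split => //; rewrite /Rintegral -E1 -E2; congr fine.
rewrite (Fubini iH1) (Fubini iH2) /=; apply: eq_integral => t _.
exact: integral_fracJ_shift.
Qed.

End fractional_duality.

(** * Composition of fractional integrals of complementary orders *)

Section fractional_semigroup.
Context {R : realType}.
Local Notation mu := (@lebesgue_measure R).
Local Notation TR := (measurableTypeR R).
Implicit Types (e s t x : R) (f g v : R -> R).

Lemma fracJZ e s f (c x : R) : measurable_fun setT f ->
  fracJ e s (fun y => c * f y) x = c * fracJ e s f x.
Proof.
move=> mf; rewrite /fracJ -measurable_RintegralZl//; last exact: measurable_shift_fkernel.
by apply: eq_Rintegral => t _; rewrite mulrA.
Qed.

(** If the fractional integral of [|g|] is at most [C], the double integral is at most [C] times the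
    L1 norm of [v]. The remaining task in each application is such a uniform bound. *)
Lemma fracJ_duality_bounded e s v g (C : R) : 0 < s <= 1 -> L1 v ->
  measurable_fun setT g ->
  (forall x, \int[mu]_t (`|g (x - (- e) * t)%R| * fkernel s t)%:E <= C%:E)%E ->
  mu.-integrable setT (fun x => (fracJ e s v x * g x)%:E) /\
  \int[mu]_x (fracJ e s v x * g x) = \int[mu]_x (fracJ (- e) s g x * v x).
Proof.
move=> s01 /integrableP[/measurable_EFinP mv fv] mg gC; apply: fracJ_duality => //.
have mgk x : measurable_fun setT (fun t : TR => (`|g (x - (- e) * t)| * fkernel s t)%:E).
  apply/measurable_EFinP; apply: (@measurable_shift_fkernel _ (- e) s (fun y => `|g y|)).
  exact: measurableT_comp.
have C0 : (0 <= C%:E)%E.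
  rewrite (le_trans _ (gC 0))// integral_ge0// => t _.
  by rewrite lee_fin mulr_ge0// fkernel_ge0.
apply: (@le_lt_trans _ _ (\int[mu]_x (C%:E * `|v x|%:E))%E).
  apply: ge0_le_integral => //.
  - by move=> x _; apply: integral_ge0 => t _; rewrite lee_fin !mulr_ge0// fkernel_ge0.
  - apply: (@measurable_fun_fubini_tonelli_F _ _ _ _ _ mu (fun z : TR * TR =>
      (`|g (z.1 - (- e) * z.2)| * fkernel s z.2 * `|v z.1|)%:E)).
      apply/measurable_EFinP.
      by apply: (@measurable_fracJ_kernel2 _ (- e) s (fun y => `|g y|) (fun y => `|v y|));
        exact: measurableT_comp.
    by move=> z; rewrite lee_fin !mulr_ge0// fkernel_ge0.
  - by apply: measurable_funeM; apply/measurable_EFinP; exact: measurableT_comp.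
  - move=> x _; under eq_integral do rewrite EFinM.
    rewrite ge0_integralZr ?lee_fin//; last first.
      by move=> t _; rewrite lee_fin mulr_ge0// fkernel_ge0.
    by rewrite lee_wpmul2r ?lee_fin.
rewrite ge0_integralZl//; last by apply/measurable_EFinP; exact: measurableT_comp.
rewrite lte_mul_pinfty//.
Qed.

(** The inner fractional integral need not be integrable, so [shift_fkernel_le] cannot be applied to
    it. Instead the absolute value moves inside and the semigroup identity leaves the integral of
    [|f|] over a half-line; [B] only ensures that the inner integral converges. *)
Lemma fracJ_comp_abs_le e s f (B N : R) x : `|e| = 1 -> 0 < s < 1 ->
  measurable_fun setT f -> (forall y, `|f y| <= B) ->
  (\int[mu]_y `|f y|%:E <= N%:E)%E ->
  (\int[mu]_t (`|fracJ e (1 - s) f (x - e * t)%R| * fkernel s t)%:E <= N%:E)%E.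
Proof.
move=> e1 s01 mf fB fN; have /andP[s0 s1] := s01.
have sp : 0 < s <= 1 by rewrite s0 ltW.
have rp : 0 < 1 - s <= 1 by rewrite subr_gt0 s1 gerBl ltW.
pose G q := `|f (x - e * q)|.
have mG : measurable_fun setT G.
  apply: measurableT_comp => //; apply: measurableT_comp => //.
  by apply: measurable_funB => //; exact: measurable_funM.
apply: (@le_trans _ _
    (\int[mu]_t \int[mu]_r (fkernel s t * fkernel (1 - s) r * G (t + r))%:E)%E).
  apply: ge0_le_integral => //.
  - by move=> t _; rewrite lee_fin mulr_ge0// fkernel_ge0.
  - apply/measurable_EFinP; apply: (@measurable_shift_fkernel _ e s
      (fun y => `|fracJ e (1 - s) f y|)).
    by apply: measurableT_comp => //; exact: measurable_fracJ.
  - apply: (@measurable_fun_fubini_tonelli_F _ _ _ _ _ mu (fun z : TR * TR =>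
      (fkernel s z.1 * fkernel (1 - s) z.2 * G (z.1 + z.2))%:E)).
      apply/measurable_EFinP; apply: measurable_funM.
        apply: measurable_funM.
          by apply: measurableT_comp; [exact: measurable_fkernel|exact: measurable_fst].
        by apply: measurableT_comp; [exact: measurable_fkernel|exact: measurable_snd].
      have := measurable_linear2 1 1 mG.
      by apply: eq_measurable_fun => z _; rewrite !mul1r.
    by move=> z; rewrite lee_fin /G !mulr_ge0// fkernel_ge0.
  - move=> t _; rewrite mulrC EFinM.
    have -> : (\int[mu]_r (fkernel s t * fkernel (1 - s) r * G (t + r))%:E =
        (fkernel s t)%:E * \int[mu]_r `|f (x - e * t - e * r)%R * fkernel (1 - s) r|%:E)%E.
      rewrite -ge0_integralZl ?lee_fin ?fkernel_ge0//; last first.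
        apply/measurable_EFinP; apply: measurableT_comp => //.
        exact: measurable_shift_fkernel.
      apply: eq_integral => r _; rewrite -EFinM normrM (ger0_norm (fkernel_ge0 _ rp)).
      by rewrite /G mulrDr opprD addrA -mulrA [X in _ * X]mulrC.
    rewrite lee_wpmul2l ?lee_fin ?fkernel_ge0//.
    have fi := integrable_shift_fkernel (x - e * t) e1 rp mf fB fN.
    by rewrite EFin_normr_Rintegral// le_abse_integral//; exact: measurable_int fi.
rewrite ge0_integral_fkernel_semigroup//; last by move=> q; rewrite /G.
apply: (@le_trans _ _ (\int[mu]_q (G q)%:E)%E).
  apply: ge0_subset_integral => //; first exact/measurable_EFinP.
  by move=> q _; rewrite lee_fin /G.
rewrite (le_trans _ fN)//.
rewrite -[leRHS](@integral_affine _ (- e) x) ?normrN//; last first.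
  by apply/measurable_EFinP; exact: measurableT_comp.
rewrite le_eqVlt; apply/orP; left; apply/eqP; apply: eq_integral => q _.
by rewrite /G mulNr addrC.
Qed.

Lemma fracJ_comp e s f (B N : R) x : `|e| = 1 -> 0 < s < 1 ->
  measurable_fun setT f -> (forall y, `|f y| <= B) ->
  (\int[mu]_y `|f y|%:E <= N%:E)%E ->
  fracJ e s (fracJ e (1 - s) f) x = \int[mu]_(q in `]0, +oo[) f (x - e * q).
Proof.
move=> e1 s01 mf fB fN; have /andP[s0 s1] := s01.
have rp : 0 < 1 - s <= 1 by rewrite subr_gt0 s1 gerBl ltW.
pose G q := f (x - e * q).
have mG : measurable_fun setT G.
  apply: measurableT_comp => //.
  by apply: measurable_funB => //; exact: measurable_funM.
have iG : mu.-integrable `]0, +oo[ (EFin \o G).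
  apply: (@integrableS _ _ _ _ setT) => //; apply/integrableP; split.
    exact/measurable_EFinP.
  rewrite (le_lt_trans _ (ltry N))// (le_trans _ fN)//.
  rewrite -[leRHS](@integral_affine _ (- e) x) ?normrN//; last first.
    by apply/measurable_EFinP; exact: measurableT_comp.
  rewrite le_eqVlt; apply/orP; left; apply/eqP; apply: eq_integral => q _.
  by rewrite /G /= mulNr addrC.
rewrite /Rintegral -(integral_fkernel_semigroup s01 mG iG) {1}/fracJ /Rintegral.
congr fine; apply: eq_integral => t _.
have fi := integrable_shift_fkernel (x - e * t) e1 rp mf fB fN.
rewrite mulrC EFinM fineK; last exact: integrable_fin_num fi.
rewrite -integralZl//; apply: eq_integral => r _.
by rewrite -EFinM /G mulrDr opprD addrA -mulrA [X in _ * X]mulrC.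
Qed.

Lemma fracJ_comp_derive1 e s f (M : R) x : `|e| = 1 -> 0 < s < 1 ->
  (forall y, derivable f y 1) -> continuous (derive1 f) ->
  (forall y, y \notin `[- M, M] -> f y = 0) ->
  fracJ e s (fracJ e (1 - s) (derive1 f)) x = e * f x.
Proof.
move=> e1 s01 df cdf f0.
have [B [N [_ _ fB fN]]] := itv_support_bounds cdf (derive1_outside_itv f0).
rewrite (fracJ_comp x e1 s01 _ fB fN); last exact: continuous_measurable_fun.
by rewrite /Rintegral (integral_derive1_support x e1 df cdf f0).
Qed.

Lemma fracJ_fracD_duality e s v f (M : R) : `|e| = 1 -> 0 < s < 1 -> L1 v ->
  (forall y, derivable f y 1) -> continuous (derive1 f) ->
  (forall y, y \notin `[- M, M] -> f y = 0) ->
  \int[mu]_x (fracJ e s v x * (- e * fracJ (- e) (1 - s) (derive1 f) x)) =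
  \int[mu]_x (v x * f x).
Proof.
move=> e1 s01 Lv df cdf f0; have ne1 : `|- e| = 1 by rewrite normrN.
have ee : e * e = 1 by rewrite -expr2 -real_normK ?num_real// e1 expr1n.
have [B [N [_ _ fB fN]]] := itv_support_bounds cdf (derive1_outside_itv f0).
have mdf : measurable_fun setT (derive1 f) by exact: continuous_measurable_fun.
have /andP[s0 s1] := s01; have sp : 0 < s <= 1 by rewrite s0 ltW.
have mJ : measurable_fun setT (fracJ (- e) (1 - s) (derive1 f)).
  exact: measurable_fracJ.
have mg : measurable_fun setT (fun x => - e * fracJ (- e) (1 - s) (derive1 f) x).
  exact: measurable_funM.
have gN x : (\int[mu]_t (`|(- e * fracJ (- e) (1 - s) (derive1 f) (x - - e * t))%R| *
    fkernel s t)%:E <= N%:E)%E.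
  rewrite (le_trans _ (fracJ_comp_abs_le x ne1 s01 mdf fB fN))//.
  by under eq_integral do rewrite normrM ne1 mul1r.
have [_ ->] := fracJ_duality_bounded sp Lv mg gN.
apply: eq_Rintegral => x _; rewrite fracJZ// (fracJ_comp_derive1 x ne1 s01 df cdf f0).
by rewrite mulrA mulrNN ee mul1r mulrC.
Qed.

End fractional_semigroup.

(** * From fractional integrals to weak fractional derivatives *)

Section weak_derivative.
Context {R : realType}.
Local Notation mu := (@lebesgue_measure R).

Definition direction_sign (s : direction) : R :=
  match s with Minus => 1 | Plus => -1 end.

Lemma normr_direction_sign s : `|direction_sign s| = 1.
Proof. by case: s; rewrite /= ?normrN1 ?normr1. Qed.

Lemma fracIE s (sigma : R) f : measurable_fun setT f ->
  fracI s sigma f = fracJ (direction_sign s) sigma f.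
Proof.
by move=> mf; apply/funext => x; case: s; rewrite (fracI_MinusE, fracI_PlusE).
Qed.

Lemma test_function_support (f : R -> R) : test_function f ->
  exists M : R, forall y, y \notin `[- M, M] -> f y = 0.
Proof.
move=> [_ /compact_bounded[M0 [_ HM]]]; exists (M0 + 1) => y yM.
apply/eqP/negPn/negP => fy; move/negP: yM; apply.
rewrite in_itv/= -ler_norml; apply: (HM (M0 + 1)); first by rewrite ltrDl.
exact: subset_closure.
Qed.

Lemma support_test_function (f : R -> R) (a b : R) : smooth f ->
  (forall y, y \notin `[a, b] -> f y = 0) -> test_function f.
Proof.
move=> sf f0; split => //; apply: (@subclosed_compact _ _ `[a, b]).
- exact: closed_closure.
- exact: segment_compact.
- have /closure_id -> : closed `[a, b]%classic by exact: interval_closed.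
  apply: closureS => x /= fx; apply/negPn/negP => /f0 fx0.
  by rewrite fx0 eqxx in fx.
Qed.

(** The minus sign in the definition of the right derivative is exactly what lets one formula cover
    both directions. *)
Lemma fracD_opposite s (alpha : R) (f : R -> R) x : 0 < alpha < 1 -> test_function f ->
  fracD (opposite s) alpha f x =
  - direction_sign s * fracJ (- direction_sign s) (1 - alpha) (derive1 f) x.
Proof.
move=> /andP[a0 a1] tf; have [M f0] := test_function_support tf.
have sf := tf.1; have df := smooth_derivable sf.
have cdf := smooth_continuous (smooth_derive1 sf).
have mf : measurable_fun setT f.
  exact: continuous_measurable_fun (smooth_continuous sf).
have rp : 0 < 1 - alpha <= 1 by rewrite subr_gt0 a1 gerBl ltW.
have D e : `|e| = 1 -> derive1 (fracJ e (1 - alpha) f) x =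
    fracJ e (1 - alpha) (derive1 f) x.
  by move=> e1; rewrite derive1E; have [] := is_derive_fracJ x e1 rp df cdf f0.
case: s => /=; rewrite (fracIE _ _ mf) /= D ?normrN1 ?normr1//.
  by rewrite mulN1r.
by rewrite opprK mul1r.
Qed.

Lemma L1_measurable (f : R -> R) : L1 f -> measurable_fun setT f.
Proof. by move=> /integrableP[/measurable_EFinP]. Qed.

Lemma measurable_fracD_opposite s (alpha : R) (f : R -> R) : 0 < alpha < 1 ->
  test_function f -> measurable_fun setT (fracD (opposite s) alpha f).
Proof.
move=> a01 tf; have cdf := smooth_continuous (smooth_derive1 tf.1).
rewrite (_ : fracD _ _ _ = fun x => - direction_sign s *
    fracJ (- direction_sign s) (1 - alpha) (derive1 f) x); last first.
  by apply/funext => x; exact: fracD_opposite.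
apply: measurable_funM => //; apply: measurable_fracJ.
exact: continuous_measurable_fun.
Qed.

Lemma fracI_weak_fracD (alpha : R) (u v : R -> R) s : 0 < alpha < 1 ->
  L1 u -> L1 v -> u = fracI s alpha v %[ae mu] -> is_weak_fracD s alpha u v.
Proof.
move=> a01 Lu Lv uv; have mv := L1_measurable Lv.
split; first by apply: open_integrable_locally => //; exact: openT.
move=> phi tphi; have [M f0] := test_function_support tphi.
have mg := measurable_fracD_opposite s a01 tphi.
have mJ := measurable_fracJ (direction_sign s) alpha mv.
rewrite -(fracJ_fracD_duality (normr_direction_sign s) a01 Lv
  (smooth_derivable tphi.1) (smooth_continuous (smooth_derive1 tphi.1)) f0).
under eq_Rintegral do rewrite -fracD_opposite//.
congr fine; apply: ae_eq_integral => //.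
- by apply/measurable_EFinP; exact: measurable_funM.
- by apply/measurable_EFinP; apply: measurable_funM => //; exact: L1_measurable.
- move: uv; apply: filterS; first exact: (ae_filter_ringOfSetsType mu).
  by move=> x /= /[apply]; rewrite fracIE// => ->.
Qed.

End weak_derivative.

(** * Test functions separate locally integrable functions *)

Section test_functions_separate.
Context {R : realType}.
Local Notation mu := (@lebesgue_measure R).

Lemma cvg_Rintegral_dominated (f_ : nat -> R -> R) (f g : R -> R) :
  (forall n, measurable_fun setT (f_ n)) ->
  (forall x, f_ n x @[n --> \oo] --> f x) ->
  mu.-integrable setT (EFin \o g) ->
  (forall n x, `|f_ n x| <= g x) ->
  mu.-integrable setT (EFin \o f) /\
  \int[mu]_x f_ n x @[n --> \oo] --> \int[mu]_x f x.
Proof.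
move=> mf_ f_f ig f_g.
have mf : measurable_fun setT f.
  by apply: (measurable_fun_cvg mf_) => x _; exact: f_f.
have [|||||int_f _ cvgf] := @dominated_convergence _ _ _ mu _ measurableT
  (fun n x => (f_ n x)%:E) (EFin \o f) (EFin \o g).
- by move=> n; apply/measurable_EFinP; exact: mf_.
- by apply/measurable_EFinP; exact: mf.
- by apply: aeW => x _; apply: cvg_EFin; [exact: nearW|exact: f_f].
- by [].
- by apply: aeW => x n _ /=; rewrite lee_fin.
split => //; apply: fine_cvg; rewrite fineK//.
exact: integrable_fin_num int_f.
Qed.

(** At [x = a] the argument is 0 and so is the step, which makes the inequality in the limit strict.
    The difference of two such limits is then the indicator of []a, b]], the kind of interval over
    which the primitive in [FTC1_lebesgue_pt] is taken. *)
Lemma cvg_smooth_step (a x : R) :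
  smooth_step (n.+1%:R * x + - (n.+1%:R * a)) @[n --> \oo] --> ((a < x)%R%:R : R).
Proof.
have [ax|xa] := ltP a x; last first.
  rewrite (_ : (fun n => _) = cst 0); first exact: cvg_cst.
  by apply/funext => n; rewrite smooth_step_le0// -mulrBr mulr_ge0_le0// subr_le0.
apply: cvg_near_cst; near=> n.
rewrite smooth_step_ge1// -mulrBr -ler_pdivrMr ?subr_gt0// mul1r.
rewrite ltW// (@lt_trans _ _ n%:R) ?ltr_nat//.
by near: n; exact: nbhs_infty_gtr.
Unshelve. all: by end_near. Qed.

Lemma integral_oc_test_zero (h : R -> R) (a b : R) : locally_integrable setT h ->
  (forall psi, test_function psi -> \int[mu]_x (h x * psi x) = 0) ->
  \int[mu]_(x in `]a, b]) h x = 0.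
Proof.
move=> [mh _ ih] h0; have [ba|ab] := leP b a.
  by rewrite set_itv_ge ?bnd_simp -?leNgt// Rintegral_set0.
pose psi (n : nat) (x : R) := smooth_step (n.+1%:R * x + - (n.+1%:R * a)) +
  (- 1) * smooth_step (n.+1%:R * x + - (n.+1%:R * b)).
(* Since [n.+1 >= 1], the second step is complete at [b + 1] for every [n]; the common support gives
   an integrable dominating function. *)
have psi_out n x : x \notin `[a, b + 1] -> psi n x = 0.
  rewrite in_itv/= negb_and -!ltNge /psi -!mulrBr => /orP[xa|bx].
    rewrite !smooth_step_le0 ?mulr0 ?addr0//; apply: mulr_ge0_le0 => //;
      rewrite subr_le0 ltW//; exact: lt_trans ab.
  have ge1 (y : R) : 1 <= y -> 1 <= n.+1%:R * y.
    by move=> y1; rewrite -[leLHS]mul1r ler_pM// ler1n.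
  rewrite !smooth_step_ge1 ?mulN1r ?subrr//; apply: ge1; first by lra.
  by lra.
have tpsi n : test_function (psi n).
  apply: (@support_test_function _ _ a (b + 1)); last exact: psi_out.
  apply: smoothD; first exact: (@smooth_affine R smooth_step _ _ smooth_smooth_step).
  apply: smoothM; first exact: smooth_cst.
  exact: (@smooth_affine R smooth_step _ _ smooth_smooth_step).
have psi1 n x : `|psi n x| <= 1.
  rewrite /psi; set p := smooth_step _; set q := smooth_step _.
  have /andP[p0 p1] : 0 <= p <= 1 by exact: smooth_step_ge0_le1.
  have /andP[q0 q1] : 0 <= q <= 1 by exact: smooth_step_ge0_le1.
  by rewrite ler_norml; apply/andP; split; lra.
have mpsi n : measurable_fun setT (psi n).
  by apply: continuous_measurable_fun; exact: smooth_continuous (tpsi n).1.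
have [|||| _ cvgI] := @cvg_Rintegral_dominated (fun n x => h x * psi n x)
    (fun x => h x * ((a < x)%R%:R + (- 1) * (b < x)%R%:R))
    (fun x => `|(h \_ `[a, b + 1]) x|).
- by move=> n; exact: measurable_funM.
- move=> x; apply: cvgM; first exact: cvg_cst.
  apply: cvgD; first exact: cvg_smooth_step.
  by apply: cvgM; [exact: cvg_cst|exact: cvg_smooth_step].
- apply: integrable_norm; rewrite -restrict_EFin -integrable_mkcond//.
  apply/integrableP; split; first by apply/measurable_EFinP; exact: measurable_funTS.
  by apply: ih => //; exact: segment_compact.
- move=> n x; rewrite patchE mem_setE; case: ifPn => [_|xab].
    by rewrite normrM ler_piMr.
  by rewrite psi_out// mulr0.
rewrite Rintegral_mkcond.
transitivity (\int[mu]_x (h x * ((a < x)%R%:R + (- 1) * (b < x)%R%:R))).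
  apply: eq_Rintegral => x _; rewrite patchE mem_setE in_itv/=.
  have [ax|xa] := ltP a x; have [bx|xb] := ltP b x => //=.
  - by rewrite mulr1 subrr mulr0.
  - by rewrite mulr0 addr0 mulr1.
  - by move: (lt_le_trans ab (ltW (lt_le_trans bx xa))); rewrite ltxx.
  - by rewrite mulr0 addr0 mulr0.
apply/esym; apply: (cvg_unique _ _ cvgI) => //.
rewrite (_ : (fun n => _) = cst 0); first exact: cvg_cst.
by apply/funext => n; exact: h0.
Qed.

(* The primitives of [h] vanish, hence so does [h] at its Lebesgue points. *)
Lemma test_zero_ae_zero (h : R -> R) : locally_integrable setT h ->
  (forall psi, test_function psi -> \int[mu]_x (h x * psi x) = 0) ->
  {ae mu, forall x, h x = 0}.
Proof.
move=> lh h0; have := lebesgue_differentiation lh.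
apply: filterS; first exact: (ae_filter_ringOfSetsType mu).
move=> x hx.
have ih : mu.-integrable [set` Interval (BRight (x - 1)) (BRight (x + 1))] (EFin \o h).
  have [mh _ ih] := lh.
  have ihc : mu.-integrable `[x - 1, x + 1] (EFin \o h).
    apply/integrableP; split; last by apply: ih => //; exact: segment_compact.
    by apply/measurable_EFinP; exact: measurable_funTS.
  apply: integrableS ihc => // y /=.
  by rewrite !in_itv/= => /andP[/ltW -> ->].
have xx1 : x < x + 1 by rewrite ltrDl.
have [|_] := FTC1_lebesgue_pt xx1 ih _ hx.
  by rewrite lte_fin gtrBl.
move=> <-; rewrite (_ : (fun y => _) = cst 0) ?derive1_cst//.
by apply/funext => y; exact: integral_oc_test_zero.
Qed.

End test_functions_separate.

(** * The converse *)

Section converse.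
Context {R : realType}.
Local Notation mu := (@lebesgue_measure R).

Lemma smooth_support_bounds (f : R -> R) (M : R) : smooth f ->
  (forall y, y \notin `[- M, M] -> f y = 0) ->
  exists B : R, exists N : R, [/\ 0 <= B, 0 <= N, (forall x, `|f x| <= B) &
    (\int[mu]_y `|f y|%:E <= N%:E)%E].
Proof. by move=> /smooth_continuous; exact: itv_support_bounds. Qed.

Lemma smooth_fracJ (e s : R) (f : R -> R) (M : R) : `|e| = 1 -> 0 < s <= 1 ->
  smooth f -> (forall y, y \notin `[- M, M] -> f y = 0) -> smooth (fracJ e s f).
Proof.
move=> e1 s01 sf f0.
apply: (@smooth_coind _ (fun g => exists2 f, smooth f &
  (forall y, y \notin `[- M, M] -> f y = 0) /\ g = fracJ e s f)); last by exists f.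
move=> _ [{sf f0}f sf [f0 ->]].
have [dJ ->] := derive1_is_derive (fun x => is_derive_fracJ x e1 s01
  (smooth_derivable sf) (smooth_continuous (smooth_derive1 sf)) f0).
split => //; exists (derive1 f); first exact: smooth_derive1.
by split => //; exact: derive1_outside_itv f0.
Qed.

Lemma derive1_fracJ (e s : R) (f : R -> R) (M : R) : `|e| = 1 -> 0 < s <= 1 ->
  smooth f -> (forall y, y \notin `[- M, M] -> f y = 0) ->
  derive1 (fracJ e s f) = fracJ e s (derive1 f).
Proof.
move=> e1 s01 sf f0.
by have [] := derive1_is_derive (fun x => is_derive_fracJ x e1 s01
  (smooth_derivable sf) (smooth_continuous (smooth_derive1 sf)) f0).
Qed.

(** As e (x - e t) = e x - t, the shifted point only moves further away from the support as t grows.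
    Truncation is therefore needed at one end only. *)
Lemma fracJ_oneside_support (e s : R) (f : R -> R) (M x : R) : `|e| = 1 ->
  (forall y, y \notin `[- M, M] -> f y = 0) -> e * x < - M -> fracJ e s f x = 0.
Proof.
move=> e1 f0 xM; rewrite /fracJ /Rintegral integral0_eq// => t _.
have [t0|t0] := leP t 0; first by rewrite fkernel_le0// mulr0.
rewrite f0 ?mul0r//; apply/negP; rewrite in_itv/= -ler_norml => xtM.
have ee : e * e = 1 by rewrite -expr2 -real_normK ?num_real// e1 expr1n.
have : `|e * (x - e * t)| <= M by rewrite normrM e1 mul1r.
by rewrite mulrBr mulrA ee mul1r ler_norml => /andP[? _]; lra.
Qed.

Lemma ge0_integral_itv_support (f : R -> R) (a b K : R) : a <= b ->
  measurable_fun setT f -> (forall x, `|f x| <= K) ->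
  (forall x, x \notin `[a, b] -> f x = 0) ->
  (\int[mu]_x `|f x|%:E <= (K * (b - a))%:E)%E.
Proof.
move=> ab mf fK f0.
apply: (@le_trans _ _ (\int[mu]_(x in `[a, b]) K%:E)%E).
  rewrite [leRHS]integral_mkcond; apply: ge0_le_integral => //.
  - by apply/measurable_EFinP; exact: measurableT_comp.
  - by apply/(measurable_restrictT _ _).1.
  - move=> x _; rewrite patchE mem_setE; case: ifPn => [_|/f0 ->].
      by rewrite lee_fin.
    by rewrite normr0.
rewrite integral_cst//= lebesgue_measure_itv/= lte_fin.
case: ifPn => [_|]; first by rewrite -EFinB -EFinM.
rewrite -leNgt => ba; rewrite mule0 lee_fin mulr_ge0 ?subr_ge0//.
by rewrite (le_trans _ (fK 0)).
Qed.

Lemma cvg_powRN (s : R) : 0 < s -> n.+1%:R `^ (- s) @[n --> \oo] --> (0 : R).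
Proof.
move=> s0; have sn0 : s != 0 by rewrite gt_eqF.
apply/cvgr0Pnorm_lt => eps eps0; near=> n.
have n0 : 0 < n.+1%:R :> R by rewrite ltr0n.
rewrite ger0_norm ?powR_ge0// powRN invf_plt ?posrE ?powR_gt0//.
have -> : eps^-1 = (eps^-1 `^ s^-1) `^ s.
  by rewrite -powRrM mulVf// powRr1// invr_ge0 ltW.
rewrite gt0_ltr_powR ?nnegrE ?powR_ge0 ?ler0n//.
rewrite (@lt_trans _ _ n%:R) ?ltr_nat//.
by near: n; exact: nbhs_infty_gtr.
Unshelve. all: by end_near. Qed.

Lemma derive1_smooth_step_out (x : R) : x \notin `[0, 1] ->
  derive1 (@smooth_step R) x = 0.
Proof.
rewrite in_itv/= negb_and -!ltNge => x01; rewrite derive1E.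
suff : is_derive x (1 : R) (@smooth_step R) 0 by case.
case/orP : x01 => [x0|x1].
  have d0 : is_derive x (1 : R) (cst 0 : R -> R) 0 by exact: is_derive_cst.
  apply: near_eq_is_derive d0; near=> y.
  by rewrite smooth_step_le0// ltW//; near: y; exact: lt_nbhsl.
have d1 : is_derive x (1 : R) (cst 1 : R -> R) 0 by exact: is_derive_cst.
apply: near_eq_is_derive d1; near=> y.
by rewrite smooth_step_ge1// ltW//; near: y; exact: lt_nbhsr.
Unshelve. all: by end_near. Qed.

(** The transition takes place where e x lies between -2 (n+1) and -(n+1). It is one-sided because
    the function to be truncated, a fractional integral with sign [- e], already vanishes for large
    e x. *)
Definition cutoff (e : R) (n : nat) (x : R) : R :=
  smooth_step (e / n.+1%:R * x + 2).

Lemma smooth_cutoff e n : smooth (cutoff e n).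
Proof. exact: (@smooth_affine R smooth_step _ _ smooth_smooth_step). Qed.

Lemma cutoff_eq0 (e : R) (n : nat) (x : R) : e * x <= - 2 * n.+1%:R -> cutoff e n x = 0.
Proof.
move=> ex; rewrite /cutoff smooth_step_le0//.
rewrite mulrAC -lerBrDr sub0r ler_pdivrMr ?ltr0n//.
Qed.

Lemma cutoff_eq1 (e : R) (n : nat) (x : R) : - n.+1%:R <= e * x -> cutoff e n x = 1.
Proof.
move=> ex; rewrite /cutoff smooth_step_ge1//.
rewrite mulrAC -lerBlDr ler_pdivlMr ?ltr0n//.
by rewrite (le_trans _ ex)//; lra.
Qed.

Lemma cutoff_norm_le1 e n x : `|cutoff e n x| <= 1.
Proof.
have /andP[c0 c1] := smooth_step_ge0_le1 (e / n.+1%:R * x + 2).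
by rewrite ger0_norm.
Qed.

Lemma cvg_cutoff e x : cutoff e n x @[n --> \oo] --> (1 : R).
Proof.
apply: cvg_near_cst; near=> n; rewrite cutoff_eq1// lerNl.
rewrite (@le_trans _ _ `|e * x|) ?ler_normr ?lexx ?orbT//.
rewrite ltW// (@lt_trans _ _ n%:R) ?ltr_nat//.
by near: n; exact: nbhs_infty_gtr.
Unshelve. all: by end_near. Qed.

Lemma derive1_cutoff e n x : derive1 (cutoff e n) x =
  derive1 (@smooth_step R) (e / n.+1%:R * x + 2) * (e / n.+1%:R).
Proof.
rewrite derive1E.
have dS : derivable (@smooth_step R) (e / n.+1%:R * x + 2) 1.
  by apply: smooth_derivable; exact: smooth_smooth_step.
by have [] := derive1_affine dS.
Qed.

Lemma derive1_smooth_step_bounded :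
  exists2 D : R, 0 <= D & forall x, `|derive1 (@smooth_step R) x| <= D.
Proof.
apply: (@continuous_itv_support_bounded _ _ 0 1); last exact: derive1_smooth_step_out.
exact: smooth_continuous (smooth_derive1 smooth_smooth_step).
Qed.

(** The layer is given by its centre and half-width so that one interval describes [[- 2 T, - T]]
    for [e = 1] and [[T, 2 T]] for [e = -1], where T = n+1. *)
Lemma derive1_cutoff_out (e : R) (n : nat) (x : R) : `|e| = 1 ->
  x \notin `[- (3 / 2 * e * n.+1%:R) - n.+1%:R / 2,
              - (3 / 2 * e * n.+1%:R) + n.+1%:R / 2] ->
  derive1 (cutoff e n) x = 0.
Proof.
move=> e1 xout; rewrite derive1_cutoff derive1_smooth_step_out ?mul0r//.
have n0 : 0 < n.+1%:R :> R by rewrite ltr0n.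
have ee : e * e = 1 by rewrite -expr2 -real_normK ?num_real// e1 expr1n.
apply: contra xout; rewrite !in_itv/= mulrAC => /andP[h1 h2].
have {}h1 : - 2 * n.+1%:R <= e * x.
  by move: h1; rewrite -lerBlDr sub0r ler_pdivlMr.
have {}h2 : e * x <= - n.+1%:R.
  by move: h2; rewrite -lerBrDr (_ : 1 - 2 = -1) ?ler_pdivrMr ?mulN1r//; ring.
move: n0 h1 h2; move: (n.+1%:R : R) => T n0 h1 h2.
have /orP[/eqP eE|/eqP eE] : (e == 1) || (e == -1).
  by rewrite -sqrf_eq1 expr2 ee.
  by move: h1 h2; rewrite eE => h1 h2; apply/andP; split; lra.
by move: h1 h2; rewrite eE => h1 h2; apply/andP; split; lra.
Qed.

(* [- e * J_{-e}^{1-a} phi'] inverts [phi = J_{-e}^a psi], which is smooth but not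
   compactly supported; cutting it off at distance [n] changes the derivative by
   [O(n^-a)], so that dominated convergence applies. *)
Lemma fracJ_test_pairing (e a : R) (u v psi : R -> R) : `|e| = 1 -> 0 < a < 1 ->
  L1 u -> L1 v ->
  (forall phi, test_function phi -> \int[mu]_x (v x * phi x) =
    \int[mu]_x (u x * (- e * fracJ (- e) (1 - a) (derive1 phi) x))) ->
  test_function psi ->
  \int[mu]_x (v x * fracJ (- e) a psi x) = \int[mu]_x (u x * psi x).
Proof.
move=> e1 a01 Lu Lv weak tpsi; have /andP[a0 a1] := a01.
have ne1 : `|- e| = 1 by rewrite normrN.
have ee : e * e = 1 by rewrite -expr2 -real_normK ?num_real// e1 expr1n.
have ap : 0 < a <= 1 by rewrite a0 ltW.
have ra : 0 < 1 - a < 1 by rewrite subr_gt0 a1 gtrBl.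
have rp : 0 < 1 - a <= 1 by rewrite subr_gt0 a1 gerBl ltW.
have aE : 1 - (1 - a) = a by rewrite subKr.
have measu := L1_measurable Lu; have mv := L1_measurable Lv.
have iu : mu.-integrable setT (EFin \o (fun x => `|u x|)) by exact: (integrable_norm Lu).
have iv : mu.-integrable setT (EFin \o (fun x => `|v x|)) by exact: (integrable_norm Lv).
have [M psi0] := test_function_support tpsi; have spsi := tpsi.1.
have dpsi0 := derive1_outside_itv psi0; have sdpsi := smooth_derive1 spsi.
have [B [N [B0 N0 psiB psiN]]] := smooth_support_bounds spsi psi0.
have [B' [N' [B'0 N'0 dpsiB dpsiN]]] := smooth_support_bounds sdpsi dpsi0.
have mpsi : measurable_fun setT psi.
  by apply: continuous_measurable_fun; exact: smooth_continuous.
have mdpsi : measurable_fun setT (derive1 psi).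
  by apply: continuous_measurable_fun; exact: smooth_continuous.
pose Psi := fracJ (- e) a psi.
have sPsi : smooth Psi by exact: smooth_fracJ ne1 ap spsi psi0.
have dPsi : derive1 Psi = fracJ (- e) a (derive1 psi).
  exact: derive1_fracJ ne1 ap spsi psi0.
have mPsi : measurable_fun setT Psi by exact: measurable_fracJ.
have mdPsi : measurable_fun setT (derive1 Psi) by rewrite dPsi; exact: measurable_fracJ.
have [C PsiC] : exists C, forall x, `|Psi x| <= C.
  by eexists => x; exact: (fracJ_abs_le x ne1 ap ltr01 mpsi psiB psiN).
have C0 : 0 <= C by rewrite (le_trans _ (PsiC 0)).
have [D D0 stepD] := derive1_smooth_step_bounded.
pose phi n x := Psi x * cutoff e n x.
have dphi n x : derive1 (phi n) x =
    derive1 Psi x * cutoff e n x + Psi x * derive1 (cutoff e n) x.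
  rewrite derive1E.
  have dc : derivable (cutoff e n) x 1.
    by apply: smooth_derivable; exact: smooth_cutoff.
  have dP : derivable Psi x 1 by exact: smooth_derivable.
  by have [] := derive1_mul dP dc.
have tphi n : test_function (phi n).
  pose L : R := `|M| + 2 * n.+1%:R.
  apply: (@support_test_function _ _ (- L) L).
    by apply: smoothM; [exact: sPsi|exact: smooth_cutoff].
  move=> y; rewrite in_itv/= -ler_norml -ltNge -[`|y|]mul1r -e1 -normrM ltr_normr.
  have n0 : 0 <= n.+1%:R :> R by [].
  case/orP => yL.
    rewrite /phi /Psi (fracJ_oneside_support _ ne1 psi0) ?mul0r// mulNr ltrN2.
    by rewrite (le_lt_trans (ler_norm _))// (le_lt_trans _ yL)// lerDl mulr_ge0.
  rewrite /phi cutoff_eq0 ?mulr0//.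
  rewrite mulNr lerNr (le_trans _ (ltW yL))// /L lerDr.
  exact: normr_ge0.
(* This constant comes from [fracJ_abs_le] with T = n+1, sup bound C D / (n+1) and L1 bound C D:
   both summands then carry the factor (n+1)^(-a). *)
pose KB := C * D * (fkernel_mass (1 - a) + (Gamma (1 - a))^-1).
pose rest n x := fracJ (- e) (1 - a) (fun y => Psi y * derive1 (cutoff e n) y) x.
have mrest n : measurable_fun setT (fun y => Psi y * derive1 (cutoff e n) y).
  apply: measurable_funM => //; apply: continuous_measurable_fun.
  by apply: smooth_continuous; apply: smooth_derive1; exact: smooth_cutoff.
have restC n x : `|Psi x * derive1 (cutoff e n) x| <= C * (D / n.+1%:R).
  rewrite normrM ler_pM// derive1_cutoff normrM ler_pM//.
  by rewrite normrM e1 mul1r ger0_norm.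
(* The layer has length n+1 and the integrand is at most C D / (n+1), so the L1 norm does not grow
   with [n]. *)
have restN n : (\int[mu]_y `|Psi y * derive1 (cutoff e n) y|%:E <= (C * D)%:E)%E.
  have n0 : 0 < n.+1%:R :> R by rewrite ltr0n.
  have := @ge0_integral_itv_support (fun y => Psi y * derive1 (cutoff e n) y)
    (- (3 / 2 * e * n.+1%:R) - n.+1%:R / 2) (- (3 / 2 * e * n.+1%:R) + n.+1%:R / 2)
    (C * (D / n.+1%:R)).
  rewrite (_ : C * (D / n.+1%:R) * _ = C * D); last by field; rewrite gt_eqF.
  apply => //; first by rewrite lerD2l lerNl; lra.
  by move=> y yout; rewrite derive1_cutoff_out// mulr0.
have restE n x : `|rest n x| <= KB * n.+1%:R `^ (- a).
  have n0 : 0 < n.+1%:R :> R by rewrite ltr0n.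
  rewrite (le_trans (fracJ_abs_le x ne1 rp n0 (mrest n) (restC n) (restN n)))//.
  rewrite /fkernel n0 /KB (_ : 1 - a - 1 = - a); last by ring.
  rewrite (_ : n.+1%:R `^ (1 - a) = n.+1%:R * n.+1%:R `^ (- a)); last first.
    rewrite -(mulr_powRB1 (ltW n0)) ?subr_gt0// (_ : 1 - a - 1 = - a)//; ring.
  rewrite le_eqVlt; apply/orP; left; apply/eqP; field.
  by rewrite !gt_eqF// Gamma_gt0.
have KB0 : 0 <= KB.
  rewrite !mulr_ge0// addr_ge0 ?invr_ge0 ?(ltW (Gamma_gt0 rp))//.
  by apply: Rintegral_ge0 => t _; exact: fkernel_ge0.
have rest_le n x : `|rest n x| <= KB.
  rewrite (le_trans (restE n x))// ler_piMr// powRN invf_le1 ?powR_gt0 ?ltr0n//.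
  by rewrite -[leLHS](powRr0 n.+1%:R) ler_powR ?ler1n// ltW.
have rest0 x : rest n x @[n --> \oo] --> (0 : R).
  apply/norm_cvg0P; apply: (@squeeze_cvgr _ _ _ _ (cst 0)
    (fun n : nat => KB * n.+1%:R `^ (- a))).
  - by near=> n; rewrite normr_ge0/=; exact: restE.
  - exact: cvg_cst.
  - rewrite -[X in _ --> X](mulr0 KB); apply: cvgM; first exact: cvg_cst.
    exact: cvg_powRN.
(* [fracJ_comp_abs_le] is used with the orders exchanged: the outer one is [1 - a], whose complement
   is [a] by [aE]. *)
have main_fin x : (\int[mu]_t (`|derive1 Psi (x - - e * t)%R| *
    fkernel (1 - a) t)%:E <= N'%:E)%E.
  by have := fracJ_comp_abs_le x ne1 ra mdpsi dpsiB dpsiN; rewrite aE -dPsi.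
have main_int x : mu.-integrable setT
    (EFin \o (fun t => `|derive1 Psi (x - - e * t)| * fkernel (1 - a) t)).
  apply/integrableP; split.
    apply/measurable_EFinP.
    apply: (@measurable_shift_fkernel _ (- e) (1 - a) (fun y => `|derive1 Psi y|)).
    exact: measurableT_comp.
  rewrite (le_lt_trans _ (ltry N'))// (le_trans _ (main_fin x))//.
  rewrite le_eqVlt; apply/orP; left; apply/eqP; apply: eq_integral => t _.
  by rewrite gee0_abs// lee_fin mulr_ge0// fkernel_ge0.
pose main n x := fracJ (- e) (1 - a) (fun y => derive1 Psi y * cutoff e n y) x.
have mcut n : measurable_fun setT (cutoff e n).
  by apply: continuous_measurable_fun; apply: smooth_continuous; exact: smooth_cutoff.
have mmain n : measurable_fun setT (fun y => derive1 Psi y * cutoff e n y).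
  exact: measurable_funM.
have main_dom n x t : `|derive1 Psi (x - - e * t) * cutoff e n (x - - e * t) *
    fkernel (1 - a) t| <= `|derive1 Psi (x - - e * t)| * fkernel (1 - a) t.
  rewrite normrM (ger0_norm (fkernel_ge0 t rp)) ler_wpM2r ?fkernel_ge0//.
  by rewrite normrM ler_piMr// cutoff_norm_le1.
have main_int_n n x : mu.-integrable setT
    (EFin \o (fun t => derive1 Psi (x - - e * t) * cutoff e n (x - - e * t) *
      fkernel (1 - a) t)).
  apply: le_integrable (main_int x) => //.
    apply/measurable_EFinP.
    exact: (@measurable_shift_fkernel _ (- e) (1 - a) _ _ (mmain n)).
  by move=> t _ /=; rewrite lee_fin (le_trans (main_dom n x t))// ler_norm.
(* The cutoffs tend to 1 under the domination just found, and the limit is a composition of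
   complementary orders applied to [derive1 psi], hence [- e * psi x]. *)
have main_cvg x : main n x @[n --> \oo] --> - e * psi x.
  rewrite -(fracJ_comp_derive1 x ne1 ra (smooth_derivable spsi)
    (smooth_continuous sdpsi) psi0) aE -dPsi.
  have [|||| _ //] := @cvg_Rintegral_dominated _
    (fun n t => derive1 Psi (x - - e * t) * cutoff e n (x - - e * t) * fkernel (1 - a) t)
    (fun t => derive1 Psi (x - - e * t) * fkernel (1 - a) t)
    (fun t => `|derive1 Psi (x - - e * t)| * fkernel (1 - a) t).
  - by move=> n; exact: (@measurable_shift_fkernel _ (- e) (1 - a) _ _ (mmain n)).
  - move=> t; apply: cvgM; last exact: cvg_cst.
    rewrite -[X in _ --> X]mulr1; apply: cvgM; first exact: cvg_cst.
    exact: cvg_cutoff.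
  - exact: main_int.
  - by move=> n t; exact: main_dom.
have main_le n x : `|main n x| <= N'.
  rewrite -lee_fin (le_trans _ (main_fin x))//.
  rewrite [leLHS](EFin_normr_Rintegral measurableT (main_int_n n x)).
  rewrite (le_trans (le_abse_integral _ _ _))//.
    exact: measurable_int (main_int_n n x).
  apply: ge0_le_integral => //.
  - by apply: measurableT_comp => //; exact: measurable_int (main_int_n n x).
  - exact: measurable_int (main_int x).
  - by move=> t _; rewrite lee_fin; exact: main_dom.
have splitE n x : fracJ (- e) (1 - a) (derive1 (phi n)) x = main n x + rest n x.
  rewrite /main /rest /fracJ -RintegralD//.
  - by apply: eq_Rintegral => t _; rewrite dphi mulrDl.
  - exact: integrable_shift_fkernel x ne1 rp (mrest n) (restC n) (restN n).
have [|||| _ cvgv] := @cvg_Rintegral_dominated _ (fun n x => v x * phi n x)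
  (fun x => v x * Psi x) (fun x => C * `|v x|).
- by move=> n; apply: measurable_funM => //; exact: measurable_funM.
- move=> x; apply: cvgM; first exact: cvg_cst.
  rewrite -[X in _ --> X]mulr1; apply: cvgM; first exact: cvg_cst.
  exact: cvg_cutoff.
- exact: (integrableZl measurableT C iv).
- move=> n x; rewrite normrM mulrC ler_wpM2r// normrM.
  by rewrite -[leRHS]mulr1 ler_pM// cutoff_norm_le1.
(* The bound [N' + KB] on the fractional derivatives is uniform in [n] and [x], which is what
   domination against an L1 function requires. *)
have [|||| _ cvgu] := @cvg_Rintegral_dominated _
  (fun n x => u x * (- e * fracJ (- e) (1 - a) (derive1 (phi n)) x))
  (fun x => u x * psi x) (fun x => (N' + KB) * `|u x|).
- move=> n; apply: measurable_funM; first exact: measu.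
  apply: measurable_funM; first exact: measurable_cst.
  apply: measurable_fracJ; apply: continuous_measurable_fun.
  by apply: smooth_continuous; apply: smooth_derive1; exact: (tphi n).1.
- move=> x; apply: cvgM; first exact: cvg_cst.
  have -> : psi x = - e * (- e * psi x + 0).
    by rewrite addr0 mulrA mulrNN ee mul1r.
  apply: cvgM; first exact: cvg_cst.
  under eq_fun do rewrite splitE.
  by apply: cvgD; [exact: main_cvg|exact: rest0].
- exact: (integrableZl measurableT (N' + KB) iu).
- move=> n x; rewrite normrM mulrC ler_wpM2r// normrM ne1 mul1r splitE.
  by apply: (le_trans (ler_normD _ _)); apply: lerD; [exact: main_le|exact: rest_le].
have cvgv' : \int[mu]_x (v x * phi n x) @[n --> \oo] --> \int[mu]_x (u x * psi x).
  rewrite (_ : (fun n : nat => \int[mu]_x (v x * phi n x)) = fun n : nat =>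
    \int[mu]_x (u x * (- e * fracJ (- e) (1 - a) (derive1 (phi n)) x))).
    exact: cvgu.
  by apply/funext => n; exact: weak (tphi n).
exact: (cvg_unique _ cvgv cvgv').
Unshelve. all: by end_near. Qed.

End converse.

(** * Recovering the function from its weak fractional derivative *)

Section weak_derivative_converse.
Context {R : realType}.
Local Notation mu := (@lebesgue_measure R).

(** Duality against the indicator of an interval containing the compact set, whose fractional
    integral is bounded. Only local integrability can be expected, since a fractional integral of an
    L1 function need not be in L1; it suffices for testing [u - fracJ e alpha v]. *)
Lemma locally_integrable_fracJ (e s : R) (v : R -> R) : `|e| = 1 -> 0 < s <= 1 ->
  L1 v -> locally_integrable setT (fracJ e s v).
Proof.
move=> e1 s01 Lv; have mv := L1_measurable Lv.
have mJ := measurable_fracJ e s mv.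
split; [exact: mJ|exact: openT|move=> K _ cK].
have [M0 [_ HM]] := compact_bounded cK.
pose M : R := `|M0| + 1.
have KM x : K x -> x \in `[- M, M].
  move=> Kx; rewrite in_itv/= -ler_norml; apply: (HM M) => //.
  by rewrite (le_lt_trans (ler_norm _))// ltrDl.
have M0' : 0 <= M by rewrite addr_ge0.
pose g : R -> R := \1_(`[- M, M]%classic).
have mg : measurable_fun setT g by exact: measurable_indic.
have g1 x : `|g x| <= 1.
  by rewrite /g indicE; case: (_ \in _); rewrite ?normr1 ?normr0.
have g0 x : x \notin `[- M, M] -> g x = 0.
  by rewrite /g indicE mem_setE => /negbTE ->.
have MM : - M <= M by rewrite (le_trans _ M0')// oppr_le0.
have gN := ge0_integral_itv_support MM mg g1 g0.
have ne1 : `|- e| = 1 by rewrite normrN.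
have [|iJ _] := @fracJ_duality_bounded _ e s v g
  (1 * (1 `^ s * fkernel_mass s) + fkernel s 1 * (1 * (M - - M))) s01 Lv mg.
  move=> x; rewrite (le_trans _ (shift_fkernel_le x ne1 s01 ltr01 mg g1 gN))//.
  rewrite le_eqVlt; apply/orP; left; apply/eqP; apply: eq_integral => t _.
  by rewrite normrM (ger0_norm (fkernel_ge0 _ s01)).
have mK : measurable K by exact: compact_measurable.
move/integrableP : iJ => [mJg]; apply: le_lt_trans.
rewrite integral_mkcond; apply: ge0_le_integral => //.
- by move=> x _; rewrite patchE; case: ifP.
- apply/(measurable_restrictT _ _).1 => //; apply: measurable_funTS.
  by apply/measurable_EFinP; exact: measurableT_comp.
- by apply: measurableT_comp => //; exact: mJg.
- move=> x _; rewrite patchE; case: ifPn => [xK|_]; last exact: abse_ge0.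
  have xM := KM _ (set_mem xK).
  by rewrite /g indicE mem_setE xM mulr1.
Qed.

Lemma weak_fracD_fracI (alpha : R) (u v w : R -> R) s : 0 < alpha < 1 ->
  L1 u -> L1 v -> is_weak_fracD s alpha u w -> w = v %[ae mu] ->
  u = fracI s alpha v %[ae mu].
Proof.
move=> a01 Lu Lv [[mw _ _] weakw] wv; have /andP[a0 a1] := a01.
have ap : 0 < alpha <= 1 by rewrite a0 ltW.
have measu := L1_measurable Lu; have mv := L1_measurable Lv.
have iu : mu.-integrable setT (EFin \o (fun x => `|u x|)) by exact: (integrable_norm Lu).
pose e : R := direction_sign s.
have e1 : `|e| = 1 by exact: normr_direction_sign.
have ne1 : `|- e| = 1 by rewrite normrN.
have weak phi : test_function phi -> \int[mu]_x (v x * phi x) =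
    \int[mu]_x (u x * (- e * fracJ (- e) (1 - alpha) (derive1 phi) x)).
  move=> tphi; transitivity (\int[mu]_x (w x * phi x)).
    have mphi : measurable_fun setT phi.
      by apply: continuous_measurable_fun; exact: smooth_continuous tphi.1.
    congr fine; apply: ae_eq_integral => //.
    - by apply/measurable_EFinP; exact: measurable_funM.
    - by apply/measurable_EFinP; exact: measurable_funM.
    - move: wv; apply: filterS; first exact: (ae_filter_ringOfSetsType mu).
      by move=> x /= /[apply] ->.
  rewrite weakw//; apply: eq_Rintegral => x _.
  by rewrite fracD_opposite.
have lJ := locally_integrable_fracJ e1 ap Lv.
have lu : locally_integrable setT u.
  by apply: open_integrable_locally; [exact: openT|exact: Lu].
have := test_zero_ae_zero (locally_integrableB lu lJ).
have mJ := measurable_fracJ e alpha mv.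
move=> H; have {H} : {ae mu, forall x, u x - fracJ e alpha v x = 0}.
  apply: H => psi tpsi; have [M psi0] := test_function_support tpsi.
  have mpsi : measurable_fun setT psi.
    by apply: continuous_measurable_fun; exact: smooth_continuous tpsi.1.
  have [B [N [B0 N0 psiB psiN]]] := smooth_support_bounds tpsi.1 psi0.
  have [|iJ EJ] := @fracJ_duality_bounded _ e alpha v psi
    (B * (1 `^ alpha * fkernel_mass alpha) + fkernel alpha 1 * N) ap Lv mpsi.
    move=> x; rewrite (le_trans _ (shift_fkernel_le x ne1 ap ltr01 mpsi psiB psiN))//.
    rewrite le_eqVlt; apply/orP; left; apply/eqP; apply: eq_integral => t _.
    by rewrite normrM (ger0_norm (fkernel_ge0 _ ap)).
  have iup : mu.-integrable setT (EFin \o (fun x => u x * psi x)).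
    apply: le_integrable (integrableZl measurableT B iu) => //.
      by apply/measurable_EFinP; exact: measurable_funM.
    move=> x _ /=; rewrite lee_fin !normrM normr_id mulrC ler_wpM2r//.
    by rewrite (le_trans (psiB x))// ler_norm.
  transitivity (\int[mu]_x (u x * psi x - fracJ e alpha v x * psi x)).
    by apply: eq_Rintegral => x _; rewrite -mulrBl.
  rewrite (RintegralB measurableT iup iJ) EJ.
  (* Duality has moved the fractional integral onto [psi], so both integrals are now pairings of [v]
     with the same function. *)
  rewrite -(fracJ_test_pairing e1 a01 Lu Lv weak tpsi).
  apply/eqP; rewrite subr_eq0; apply/eqP; apply: eq_Rintegral => x _.
  by rewrite mulrC.
apply: filterS; first exact: (ae_filter_ringOfSetsType mu).
move=> x /= + _; rewrite (fracIE _ _ mv) -/e => /eqP.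
by rewrite subr_eq0 => /eqP.
Qed.

End weak_derivative_converse.

Theorem theorem4p6 (R : realType) (alpha : R) (u v : R -> R) (s : direction)
    (halpha : 0 < alpha < 1) (hu : L1 u) (hv : L1 v) :
  (u = fracI s alpha v %[ae @lebesgue_measure R] ->
     weak_fracD_ae_eq s alpha u v) /\
  (vanishes_ae_at_infinity u ->
     weak_fracD_ae_eq s alpha u v ->
     u = fracI s alpha v %[ae @lebesgue_measure R]).
Proof.
split=> [uv|_ [w ww wv]]; last exact: weak_fracD_fracI ww wv.
exists v; first exact: fracI_weak_fracD.
exact: ae_eq_refl.
Qed.
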